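(* Let $k\ge 1$ be an integer and let $\alpha,c,N$ be real numbers such that none of $\alpha+c-N+1$, $\alpha-N+1$, $\alpha+c-k-1$, $c-k-1$ belongs to $\{0,-1,-2,\dots\}$. Let $r_0=1$, $r_j(x)=(-1)^j\prod_{i=0}^{j-1}[x+i(\alpha+c-N-2-i)]$ for $j\ge 1$, and let $h^*_{1,k}$ be the dual Hahn polynomial $$h^*_{1,k}(x)=\sum_{j=0}^k\frac{(-k)_j(2-\alpha-c+j)_{k-j}(2-c+j)_{k-j}}{j!}r_j(x).$$ Assume $h^*_{1,k}(n(n-2-N+\alpha+c))\neq 0$ for all $n\ge 0$. Define polynomials of degrees $k$ and $k+1$, respectively, by $$P_2(x)=h^*_{1,k}(x),$$ $$P_1(x)=(\alpha+c-N)h^*_{1,k}(x)+2(x-\alpha-c+N+1)\sum_{j=0}^k\frac{(-k)_j(2-\alpha-c+j)_{k-j}(2-c+j)_{k-j}}{(j+1)!}r_j(x).$$ Put $\theta_n=(n+1)(n+\alpha+c-N-1)$, $\sigma_n=2n+\alpha+c-N-2$, and define $$\gamma_n=h^*_{1,k}(n(n-2-N+\alpha+c)),\qquad \beta_n=\frac{n(N-n)(n+\alpha-N)}{(2n+\alpha+c-N-1)(2n+\alpha+c-N-2)}\frac{\gamma_{n+1}}{\gamma_n}\quad(n\ge 1),$$ $$\lambda_n=\frac{\sigma_n\gamma_n+P_1(\theta_{n-1})}{2}\ (n\ge 1),\qquad \lambda_0=\frac{P_1(\theta_0)-\sigma_1P_2(\theta_0)}{2},$$ and $q_0=1$, $q_n(x)=h_n^{\alpha,c,N}(x)+\beta_nh_{n-1}^{\alpha,c,N}(x)$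 for $n\ge 1$, where $(h_n^{\alpha,c,N})_n$ are the Hahn polynomials. Let $$\tilde\rho=(x+c-1)\cdots(x+c-k)\,\rho_{\alpha,c-k-1,N},$$ where $\rho_{\alpha,c-k-1,N}$ is the Hahn moment functional with parameters $\alpha,c-k-1,N$. If $N$ is not a positive integer, then the polynomials $(q_n)_n$ are orthogonal with respect to the moment functional $\tilde\rho$. If $N$ is a positive integer, then the polynomials $(q_n)_{0\le n\le N}$ are orthogonal with respect to the measure $$\tilde\rho=\Gamma(N)\sum_{x=0}^{N-1}\frac{\Gamma(\alpha-x)\Gamma(x+c)}{(x+c-k-1)\Gamma(N-x)x!}\,\delta_x.$$ Moreover, for the difference operator of order $2k+2$ and genre $(-k-1,k+1)$ $$D=\tfrac12P_1(D_{\alpha,c,N})+\Big(-\tfrac{\alpha+c-N}{2}I+(-x+N-1)\Delta\Big)P_2(D_{\alpha,c,N}),$$ where $D_{\alpha,c,N}$ is the second order Hahn difference operator, one has $D(q_n)=\lambda_nq_n$.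
   Context: For $l\in\mathbb{Z}$ the shift operator $\mathfrak{s}_l$ acts on polynomials by $\mathfrak{s}_l(f)(x)=f(x+l)$; $\Delta f(x)=f(x+1)-f(x)$, $I$ is the identity. A finite difference operator $\sum_{l=s}^r f_l\,\mathfrak{s}_l$ (with polynomial coefficients $f_l$) with $f_s,f_r\neq 0$ has order $r-s$ and genre $(s,r)$. For a linear operator $T$ and a polynomial $P(x)=\sum_j a_jx^j$, $P(T)=\sum_j a_jT^j$; products of operators are compositions. $(y)_j=y(y+1)\cdots(y+j-1)$, $(y)_0=1$. Monic Hahn polynomials ($\alpha+c-N\neq -1,-2,\dots$): $h_n^{\alpha,c,N}(x)=\sum_{j=0}^n\frac{(-n)_j(-x)_j(1-N+j)_{n-j}(c+j)_{n-j}}{(n+\alpha+c-N+j)_{n-j}\,j!}$. Hahn operator: $$D_{\alpha,c,N}=x(x-\alpha)\mathfrak{s}_{-1}+[-2x^2+(\alpha-c+N-1)x+\alpha+N(c-1)-1]\mathfrak{s}_0+(x+c)(x-N+1)\mathfrak{s}_1,$$ $D_{\alpha,c,N}(h_n^{\alpha,c,N})=(n+1)(n+\alpha+c-N-1)h_n^{\alpha,c,N}$. A moment functional is a linear map $\mu:\mathbb{P}\to\mathbb{R}$ on the space $\mathbb{P}$ of real polynomials; for a polynomial $r$, $\langle r\mu,p\rangle=\langle\mu,rp\rangle$. Hahn moment functional $\rho_{\alpha,c,N}$: if $N$ is not a positive integer and none of $\alpha+c-N+1,\alpha-N+1,\alpha+c,c$ is in $\{0,-1,-2,\dots\}$, it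 is the moment functional with respect to which $(h_n^{\alpha,c,N})_n$ are orthogonal, normalized by $\langle\rho_{\alpha,c,N},1\rangle=\frac{\Gamma(\alpha+1-N)\Gamma(c)\Gamma(\alpha+c)}{\Gamma(\alpha+c+1-N)}$; if $N$ is a positive integer, it is the measure $\rho_{\alpha,c,N}=\Gamma(N)\sum_{x=0}^{N-1}\frac{\Gamma(\alpha-x)\Gamma(x+c)}{\Gamma(N-x)x!}\delta_x$. Polynomials $(q_n)_n$ (finitely or infinitely many) with $\deg q_n=n$ are orthogonal with respect to $\mu$ if $\langle\mu,q_nx^m\rangle=0$ for $0\le m<n$ and $\langle\mu,q_nx^n\rangle\neq 0$.
   Formalization: Assumes α+c−N≠0, since β_1 is otherwise undefined; for N a positive integer, ⟨ρ̃,q_N x^N⟩≠0 is dropped (it always vanishes, as ρ̃ has N support points): full orthogonality for n<N, and for n=N only deg q_N=N and ⟨ρ̃,q_N x^m⟩=0 for m<N. *)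

(* Defs.v *)
From HB Require Import structures.
From mathcomp Require Import all_boot all_order all_algebra.
From mathcomp Require Import all_classical all_reals all_analysis.

Set Implicit Arguments.
Unset Strict Implicit.
Unset Printing Implicit Defensive.

Import Order.TTheory GRing.Theory Num.Theory.
Import numFieldNormedType.Exports.

Local Open Scope ring_scope.

(* The rising factorial (y)_n, in any ring: for numbers and polynomials. *)
Definition rising (S : pzRingType) (y : S) (n : nat) : S :=
  \prod_(i < n) (y + i%:R).

Section Gamma.
Variable R : realType.

(* Euler's integral; meaningful for 0 < x only. *)
Definition euler_integral (x : R) : R :=
  (\int[lebesgue_measure]_(t in `]0%R, +oo[%classic)
     (t `^ (x - 1) * expR (- t)))%R.

(* The extension to the negative axis divides Gamma (x + m) by (x)_m, for the
   least m with 0 < x + m. The value at the poles 0, -1, -2, ... is 0. *)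
Definition Gamma (x : R) : R :=
  let m := if 0 < x then 0%N else (Num.truncn (- x)).+1 in
  euler_integral (x + m%:R) / rising x m.

Definition nonpos_integer (x : R) : Prop := exists m : nat, x = - m%:R.

Definition pos_integer (x : R) : Prop :=
  exists m : nat, (0 < m)%N /\ x = m%:R.

End Gamma.

Section Functionals.
Variable R : realType.

(* A moment functional is an element of {scalar {poly R}}. *)

Definition discrete_functional (M : nat) (w : nat -> R) (p : {poly R}) : R :=
  \sum_(x < M) w x * p.[x%:R].

Fact discrete_functional_is_scalar M w : scalar (discrete_functional M w).
Proof.
move=> a p q; rewrite /discrete_functional mulr_sumr -big_split /=.
by apply: eq_bigr => x _; rewrite hornerD hornerZ mulrDr mulrCA.
Qed.

HB.instance Definition _ M w := GRing.isLinear.Build R {poly R} R *%R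
  (discrete_functional M w) (discrete_functional_is_scalar M w).

Definition mul_functional (r : {poly R}) (mu : {scalar {poly R}})
  (p : {poly R}) : R := mu (r * p).

Fact mul_functional_is_scalar r mu : scalar (mul_functional r mu).
Proof.
by move=> a p q; rewrite /mul_functional mulrDr -scalerAr linearP.
Qed.

HB.instance Definition _ r mu := GRing.isLinear.Build R {poly R} R *%R
  (mul_functional r mu) (mul_functional_is_scalar r mu).

(* Orthogonality of the family (q n) with n ranging over I. *)
Definition orthogonal_on (I : pred nat) (mu : {scalar {poly R}})
    (q : nat -> {poly R}) : Prop :=
  forall n, I n ->
    [/\ size (q n) = n.+1,
        forall m, (m < n)%N -> mu (q n * 'X^m) = 0
      & mu (q n * 'X^n) != 0].

End Functionals.

Section Operators.
Variable R : realType.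
Implicit Types (p P : {poly R}) (T : {poly R} -> {poly R}).

Definition shiftp (l : int) p : {poly R} := p \Po ('X + (l%:~R)%:P).

Definition Delta p : {poly R} := shiftp 1 p - p.

(* P(T) *)
Definition poly_op P T p : {poly R} := \sum_(j < size P) P`_j *: iter j T p.

(* T = \sum_(s <= l <= r) f_l s_l with f_s and f_r nonzero. *)
Definition has_genre T (s r : int) : Prop :=
  s <= r /\
  exists f : int -> {poly R},
    [/\ f s != 0, f r != 0
      & forall p, T p =
          \sum_(i < `|r - s|.+1) f (s + i%:Z) * shiftp (s + i%:Z) p].

Definition has_order T (d : nat) : Prop :=
  exists s r : int, has_genre T s r /\ r - s = d%:Z.

End Operators.

Section Hahn.
Variable R : realType.
Variables alpha c N : R.

Definition hahn (n : nat) : {poly R} :=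
  \sum_(j < n.+1)
    (rising (- n%:R) j * rising (1 - N + j%:R) (n - j)
       * rising (c + j%:R) (n - j)
       / (rising (n%:R + alpha + c - N + j%:R) (n - j) * (j`!)%:R))
    *: rising (- 'X) j.

Definition hahn_op (p : {poly R}) : {poly R} :=
  'X * ('X - alpha%:P) * shiftp (-1) p
  + ((-2)%:P * 'X^2 + (alpha - c + N - 1)%:P * 'X
       + (alpha + N * (c - 1) - 1)%:P) * shiftp 0 p
  + ('X + c%:P) * ('X - N%:P + 1) * shiftp 1 p.

Definition hahn_weight (x : nat) : R :=
  Gamma N * (Gamma (alpha - x%:R) * Gamma (x%:R + c)
             / (Gamma (N - x%:R) * (x`!)%:R)).

(* rho is the Hahn functional with parameters alpha, c, N. If N is not a
   positive integer, this requires the parameters to be admissible. *)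
Definition hahn_functional (rho : {scalar {poly R}}) : Prop :=
  (~ pos_integer N /\
   [/\ ~ nonpos_integer (alpha + c - N + 1),
       ~ nonpos_integer (alpha - N + 1),
       ~ nonpos_integer (alpha + c)
     & ~ nonpos_integer c] /\
   orthogonal_on xpredT rho hahn /\
   rho 1 = Gamma (alpha + 1 - N) * Gamma c * Gamma (alpha + c)
           / Gamma (alpha + c + 1 - N))
  \/ (exists M : nat, [/\ (0 < M)%N, N = M%:R
        & forall p, rho p = discrete_functional M hahn_weight p]).

End Hahn.

Section KrallHahn.
Variable R : realType.
Variables (k : nat) (alpha c N : R).

Definition dual_basis (j : nat) : {poly R} :=
  (-1) ^+ j *:
  \prod_(i < j) ('X + (i%:R * (alpha + c - N - 2 - i%:R))%:P).

Definition dual_coef (j : nat) : R :=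
  rising (- k%:R) j * rising (2 - alpha - c + j%:R) (k - j)
    * rising (2 - c + j%:R) (k - j).

Definition dual_hahn : {poly R} :=
  \sum_(j < k.+1) (dual_coef j / (j`!)%:R) *: dual_basis j.

Definition P2 : {poly R} := dual_hahn.

Definition P1 : {poly R} :=
  (alpha + c - N) *: dual_hahn
  + 2 *: ('X - (alpha + c - N - 1)%:P)
    * \sum_(j < k.+1) (dual_coef j / (j.+1`!)%:R) *: dual_basis j.

Definition theta (n : nat) : R :=
  (n%:R + 1) * (n%:R + alpha + c - N - 1).

Definition sigma (n : nat) : R := 2 * n%:R + alpha + c - N - 2.

Definition gamma (n : nat) : R :=
  dual_hahn.[n%:R * (n%:R - 2 - N + alpha + c)].

Definition beta (n : nat) : R :=
  n%:R * (N - n%:R) * (n%:R + alpha - N)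
    / ((2 * n%:R + alpha + c - N - 1) * (2 * n%:R + alpha + c - N - 2))
    * (gamma n.+1 / gamma n).

Definition lambda (n : nat) : R :=
  if n is m.+1 then (sigma n * gamma n + P1.[theta m]) / 2
  else (P1.[theta 0] - sigma 1 * P2.[theta 0]) / 2.

Definition q (n : nat) : {poly R} :=
  if n is m.+1 then hahn alpha c N n + beta n *: hahn alpha c N m else 1.

(* (x + c - 1) ... (x + c - k) rho *)
Definition rho_tilde (rho : {scalar {poly R}}) : {scalar {poly R}} :=
  mul_functional (\prod_(1 <= i < k.+1) ('X + (c - i%:R)%:P)) rho.

Definition rho_tilde_weight (x : nat) : R :=
  Gamma N * (Gamma (alpha - x%:R) * Gamma (x%:R + c)
    / ((x%:R + c - k%:R - 1) * Gamma (N - x%:R) * (x`!)%:R)).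

Definition D_op (p : {poly R}) : {poly R} :=
  let T := hahn_op alpha c N in
  2^-1 *: poly_op P1 T p
  + (- ((alpha + c - N) / 2) *: poly_op P2 T p
     + (- 'X + N%:P - 1) * Delta (poly_op P2 T p)).

End KrallHahn.

(* Main.v *)
Require Import Defs.
From HB Require Import structures.
From mathcomp Require Import all_boot all_order all_algebra.
From mathcomp Require Import all_classical all_reals all_analysis.
From mathcomp Require Import measurable_realfun ring zify.

(** Write a = alpha + c - N, c' = c - k - 1, let T be the Hahn operator and
    h_n the Hahn polynomials with parameters alpha, c, N. In the basis of the
    polynomials (-x)_j both T and the lowering operator L = (N - 1 - x) Delta
    are bidiagonal, which gives T h_n = theta_n h_n and reduces every identity
    between Hahn polynomials to one between their coefficients.

    The combination h_n + e_n h_(n-1), where e_n is beta_n without its factor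
    gamma_(n+1) / gamma_n, is the Hahn polynomial with c replaced by c - 1
    (hahn_contiguous), and L maps it to a combination of h_n and h_(n-1) alone
    (lowering_hahn). As gamma_(n+1) = P2(theta_n), the operator P2(T) sends
    q_n to gamma_(n+1) (h_n + e_n h_(n-1)). Hence D q_n lies in the span of h_n
    and h_(n-1), and it is a multiple of q_n because
    P1(theta_n) - P1(theta_(n-1)) = sigma_(n+1) P2(theta_n)
    + sigma_n P2(theta_(n-1)) (P1_difference, D_op_eigen). The genre follows
    from the extreme coefficients alone (banded).

    For the orthogonality, a Hahn functional is described by its moments
    against (-x)_i (hahn_moments). Multiplying it by (x + c)_s gives a Hahn
    functional with parameter c + s, and Hahn polynomials are orthogonal for it
    by the Chu-Vandermonde identity, when tested against (alpha - x)_j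
    (hahn_orthogonal, hahn_norm_neq0). Let rho' be the functional with
    parameter c', and mu = (x + c' + 1)_k rho' the perturbed one. Then
    (x + c') mu is a Hahn functional of parameter c, so that mu kills
    q_n (x + c') x^i for i + 2 <= n. It remains to see that mu(q_n) = 0. The
    adjoint of T - theta_(-j-1) maps (x + c')_(t+1) rho' to a multiple of
    (x + c')_t rho' when t + j + 1 = k (ladder_hahn), and these eigenvalues are
    the roots of the factors of the dual Hahn basis. Therefore P2(T), followed
    by the Hahn functional of parameter c - 1, is a nonzero multiple of mu
    (dual_hahn_link), and mu(q_n) is a multiple of the value of that
    functional at the Hahn polynomial with parameter c - 1, which is 0.

    Both definitions of the Hahn functional have these moments: for an
    orthogonality functional by recursion on the degree
    (moments_of_orthogonal), and for the discrete measure by the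
    Chu-Vandermonde identity, once Gamma (y + 1) = y Gamma (y) is established
    for the integral definition of Gamma (discrete_moments). *)

Import Order.TTheory GRing.Theory Num.Theory.
Import numFieldNormedType.Exports.

Set Implicit Arguments.
Unset Strict Implicit.
Unset Printing Implicit Defensive.

Local Open Scope ring_scope.

(** * Rising factorials and the Chu-Vandermonde identity *)

Section RisingFactorial.
Variable S : comPzRingType.
Implicit Types (y z : S) (m n : nat).

Lemma rising0 y : rising y 0 = 1.
Proof. by rewrite /rising big_ord0. Qed.

Lemma rising1 y : rising y 1 = y.
Proof. by rewrite /rising big_ord1 addr0. Qed.

Lemma risingSr y n : rising y n.+1 = rising y n * (y + n%:R).
Proof. by rewrite /rising big_ord_recr. Qed.

Lemma risingD y m n : rising y (m + n) = rising y m * rising (y + m%:R) n.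
Proof.
rewrite /rising big_split_ord /=; congr (_ * _); apply: eq_bigr => i _.
by rewrite natrD addrA.
Qed.

Lemma risingSl y n : rising y n.+1 = y * rising (y + 1) n.
Proof. by rewrite -add1n risingD rising1. Qed.

(** Reading the product backwards; this is what turns the alternating sum below
    into the plain Chu-Vandermonde sum. *)
Lemma rising_reflect y n : rising y n = (-1) ^+ n * rising (1 - y - n%:R) n.
Proof.
elim: n y => [|n IH] y; first by rewrite !rising0 mulr1.
rewrite risingSl IH risingSr exprS.
have -> : 1 - (y + 1) - n%:R = 1 - y - n.+1%:R by rewrite -nat1r; ring.
rewrite -nat1r; ring.
Qed.

Lemma rising_opp_nat n i : rising (- n%:R : S) i = (-1) ^+ i * (n ^_ i)%:R.
Proof.
elim: i => [|i IH]; first by rewrite rising0 ffactn0 mulr1.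
rewrite risingSr IH exprSr; have [le_in|lt_ni] := leqP i n.
  by rewrite ffactnSr natrM natrB //; ring.
by rewrite !ffact_small ?leqW // !mulr0 mul0r.
Qed.

(** Pascal's rule in summed form: it is the induction step of Vandermonde's
    identity, since the two shifted terms always recombine into one linear
    factor. *)
Lemma sum_binomialS n (f : nat -> S) :
  \sum_(i < n.+2) 'C(n.+1, i)%:R * f i =
  \sum_(i < n.+1) 'C(n, i)%:R * (f i + f i.+1).
Proof.
rewrite big_ord_recl bin0 mul1r.
under eq_bigr => i _ do rewrite lift0 binS natrD mulrDl.
under [RHS]eq_bigr => i _ do rewrite mulrDr.
rewrite !big_split /= addrA; congr (_ + _).
rewrite big_ord_recr /= bin_small // mul0r addr0.
by rewrite [RHS]big_ord_recl bin0 mul1r.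
Qed.

Theorem Vandermonde_rising n y z :
  \sum_(i < n.+1) 'C(n, i)%:R * (rising y (n - i) * rising z i) = rising (y + z) n.
Proof.
elim: n => [|n IH]; first by rewrite big_ord1 bin0 !rising0 !mulr1.
rewrite (sum_binomialS n (fun i => rising y (n.+1 - i) * rising z i)).
rewrite risingSr -IH mulr_suml; apply: eq_bigr => i _.
have le_in : (i <= n)%N by rewrite -ltnS.
rewrite subSn // subSS !risingSr natrB //; ring.
Qed.

(** This is the terminating Gauss sum 2F1(-n, b; d; 1) = (d - b)_n / (d)_n with
    its denominators cleared, hence valid in every commutative ring. *)
Corollary Vandermonde_alternating n (b d : S) :
  \sum_(i < n.+1) 'C(n, i)%:R * ((-1) ^+ i * rising b i * rising (d + i%:R) (n - i))
  = rising (d - b) n.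
Proof.
rewrite (rising_reflect (d - b)).
have -> : 1 - (d - b) - n%:R = (1 - d - n%:R) + b by ring.
rewrite -Vandermonde_rising mulr_sumr; apply: eq_bigr => i _.
have le_in : (i <= n)%N by rewrite -ltnS.
rewrite (rising_reflect (d + i%:R)) natrB //.
have -> : 1 - (d + i%:R) - (n%:R - i%:R) = 1 - d - n%:R by ring.
have -> : (-1) ^+ n = (-1) ^+ (n - i) * (-1) ^+ i :> S by rewrite -exprD subnK.
ring.
Qed.

(** The coefficient is n! / t!. This expansion of (y + 1)_n is what resums, in
    the final link between functionals, the k + 1 terms of the dual Hahn
    polynomial. *)
Lemma rising_shift1 y n :
  rising (y + 1) n = \sum_(t < n.+1) (n ^_ (n - t))%:R * rising y t.
Proof.
elim: n => [|n IH]; first by rewrite big_ord1 !rising0 mulr1.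
rewrite big_ord_recr subnn /= ffactn0 mul1r.
under eq_bigr => i _ do rewrite subSn -1?ltnS // ffactSS natrM -mulrA.
rewrite -mulr_sumr -IH risingSr risingSl -nat1r; ring.
Qed.

End RisingFactorial.

Section NonposInteger.
Variable R : realType.
Implicit Types y : R.

Lemma nonpos_integerD y n : nonpos_integer (y + n%:R) -> nonpos_integer y.
Proof.
by move=> [m e]; exists (m + n)%N; rewrite natrD opprD -e addrK.
Qed.

Lemma addn_neq0 y n : ~ nonpos_integer y -> y + n%:R != 0.
Proof. by move=> hy; apply/eqP => e; apply: hy; exists n; apply/eqP; rewrite -addr_eq0 e. Qed.

Lemma rising_neq0 y n : ~ nonpos_integer y -> rising y n != 0.
Proof. by move=> hy; apply/prodf_neq0 => i _; exact: addn_neq0. Qed.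

End NonposInteger.

(** * Euler's integral and the functional equation of Gamma *)

Section EulerIntegral.
Local Open Scope classical_set_scope.
Local Open Scope ring_scope.
Variable R : realType.
Implicit Types (x t : R).
Local Notation mu := (@lebesgue_measure R).

Definition euler_integrand x t : R := t `^ (x - 1) * expR (- t).

(** The integral is kept in the extended reals: the functional equation is
    first an equality of possibly infinite integrals, and finiteness is deduced
    from it. *)
Definition ext_euler_integral x : \bar R :=
  (\int[mu]_(t in `]0%R, +oo[) (euler_integrand x t)%:E)%E.

Lemma euler_integralE x : euler_integral x = fine (ext_euler_integral x).
Proof. by []. Qed.

Lemma euler_integrand_ge0 x t : 0 <= euler_integrand x t.
Proof. by rewrite mulr_ge0 ?powR_ge0 ?expR_ge0. Qed.

Lemma continuous_powR x t : 0 < t -> {for t, continuous (fun s : R => s `^ x)}.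
Proof.
move=> t0; apply: differentiable_continuous; apply/derivable1_diffP.
by apply: derivable_powR; rewrite in_itv /= t0.
Qed.

Lemma continuous_expRN t : {for t, continuous (fun s : R => expR (- s))}.
Proof.
by apply: continuous_comp; [exact: opp_continuous|exact: continuous_expR].
Qed.

Lemma measurable_euler_integrand x (A : set R) :
  measurable_fun A (fun t : R => (euler_integrand x t)%:E).
Proof.
apply/measurable_EFinP; apply: measurable_funM.
  apply: measurable_funTS; exact: measurable_powR.
apply: measurableT_comp; first exact: measurable_expR.
by [].
Qed.

(** Integration by parts is available on compact intervals only, and at 0 the
    derivative of t^x may blow up; these intervals stay away from both ends. *)
Definition exhaustion (n : nat) : set R := `[n.+1%:R^-1, n.+2%:R]%classic.

Lemma exhaustion_nondecreasing : nondecreasing_seq exhaustion.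
Proof.
move=> m n mn; apply/subsetPset => t; rewrite /exhaustion /= !in_itv /=.
move=> /andP[h1 h2]; apply/andP; split.
  by apply: le_trans h1; rewrite lef_pV2 ?posrE ?ltr0n // ler_nat ltnS.
by apply: (le_trans h2); rewrite ler_nat !ltnS.
Qed.

Lemma bigcup_exhaustion : \bigcup_n exhaustion n = `]0, +oo[%classic.
Proof.
apply/seteqP; split=> t /=; rewrite /exhaustion /= ?in_itv /= ?andbT.
  move=> [n _]; rewrite /= in_itv /= => /andP[h _].
  by apply: lt_le_trans h; rewrite invr_gt0 ltr0n.
move=> t0; pose n := (Num.truncn t + Num.truncn t^-1)%N.
exists n => //=; rewrite in_itv /=; apply/andP; split.
  rewrite -[leRHS]invrK lef_pV2 ?posrE ?invr_gt0 ?ltr0n //.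
  have /ltW h := truncnS_gt t^-1.
  by apply: (le_trans h); rewrite ler_nat ltnS leq_addl.
have /ltW h := truncnS_gt t.
by apply: (le_trans h); rewrite ler_nat !ltnS /n -addnS leq_addr.
Qed.

Lemma cvg_ext_euler_integral x :
  (\int[mu]_(t in exhaustion n) (euler_integrand x t)%:E)%E @[n --> \oo]
    --> ext_euler_integral x.
Proof.
rewrite /ext_euler_integral -bigcup_exhaustion.
apply: ge0_nondecreasing_set_cvg_integral.
- exact: exhaustion_nondecreasing.
- by move=> i; exact: measurable_itv.
- by move=> i; exact: measurable_euler_integrand.
- by move=> i t _; rewrite lee_fin euler_integrand_ge0.
Qed.

(** For m > x the term u^(m+1) / (m+1)! of the exponential series dominates u^x
    by a factor of order u. *)
Lemma cvg_powR_expRN x : 0 < x -> n.+2%:R `^ x * expR (- n.+2%:R) @[n --> \oo] --> (0 : R).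
Proof.
move=> x0; pose m := (Num.truncn x).+1.
pose C : R := m.+1`!%:R.
apply: (@squeeze_cvgr _ _ _ _ (fun=> 0) (fun n => C * n.+1%:R^-1)); last 2 first.
- exact: cvg_cst.
- rewrite -(mulr0 C); apply: cvgMr; exact: cvg_harmonic.
apply: nearW => n; rewrite mulr_ge0 ?powR_ge0 ?expR_ge0 //=.
set u : R := n.+2%:R.
have u0 : 0 < u by rewrite ltr0n.
have u1 : 1 <= u by rewrite ler1n.
have h1 : u `^ x <= u ^+ m.
  rewrite -powR_mulrn ?(ltW u0) //; apply: ler_powR => //.
  exact/ltW/truncnS_gt.
have h2 : u ^+ m.+1 / C <= expR u.
  by apply: le_trans (expR_ge1Dxn m (ltW u0)); rewrite lerDr.
have C0 : 0 < C by rewrite ltr0n fact_gt0.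
have h3 : u ^+ m / expR u <= C / u.
  rewrite ler_pdivrMr ?expR_gt0 // mulrAC ler_pdivlMr //.
  by rewrite -exprSr -ler_pdivrMl // mulrC.
rewrite expRN; apply: (@le_trans _ _ (u ^+ m / expR u)).
  by rewrite ler_wpM2r // invr_ge0 expR_ge0.
apply: (le_trans h3); rewrite ler_wpM2l ?(ltW C0) //.
by rewrite lef_pV2 ?posrE ?ltr0n // ler_nat.
Qed.

Lemma cvg_powRV_expRN x : 0 < x ->
  n.+1%:R^-1 `^ x * expR (- n.+1%:R^-1) @[n --> \oo] --> (0 : R).
Proof.
move=> x0.
have h : n.+1%:R^-1 `^ x @[n --> \oo] --> (0 : R).
  have := @powR_cvg0 R x x0.
  move=> /cvg_at_rightP; apply; split; last exact: cvg_harmonic.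
  by move=> n; rewrite invr_gt0 ltr0n.
apply: (@squeeze_cvgr _ _ _ _ (fun=> 0) (fun n => n.+1%:R^-1 `^ x)) => //.
  apply: nearW => n; rewrite mulr_ge0 ?powR_ge0 ?expR_ge0 //=.
  by rewrite ler_piMr ?powR_ge0 // expR_le1 oppr_le0 invr_ge0 ler0n.
exact: cvg_cst.
Qed.

Lemma ext_euler_integral_ge0 x : (0 <= ext_euler_integral x)%E.
Proof. by apply: integral_ge0 => t _; rewrite lee_fin euler_integrand_ge0. Qed.

(** Integration by parts on each compact interval; both boundary terms tend to
    0 and monotone convergence passes to the limit on the two integrals. *)
Lemma ext_euler_integralS x : 0 < x ->
  ext_euler_integral (x + 1) = (x%:E * ext_euler_integral x)%E.
Proof.
move=> x0.
pose F (t : R) := t `^ x; pose f (t : R) := x * t `^ (x - 1).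
pose G (t : R) := - expR (- t); pose g (t : R) := expR (- t).
pose B n := F n.+2%:R * G n.+2%:R - F n.+1%:R^-1 * G n.+1%:R^-1.
have step n : (\int[mu]_(t in exhaustion n) (euler_integrand (x + 1) t)%:E =
    (B n)%:E + x%:E * \int[mu]_(t in exhaustion n) (euler_integrand x t)%:E)%E.
  have ab : n.+1%:R^-1 < n.+2%:R :> R.
    apply: (@le_lt_trans _ _ 1); last by rewrite ltr1n.
    by rewrite invf_le1 ?ler1n ?ltr0n.
  have a0 : 0 < n.+1%:R^-1 :> R by rewrite invr_gt0 ltr0n.
  have gt0 t : t \in `[n.+1%:R^-1, n.+2%:R] -> 0 < t.
    by rewrite in_itv /= => /andP[h _]; exact: lt_le_trans h.
  have oo_gt0 t : t \in `]n.+1%:R^-1, n.+2%:R[ -> 0 < t.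
    by move=> /subset_itv_oo_cc /gt0.
  have cF t : 0 < t -> {for t, continuous F} by exact: continuous_powR.
  have cG t : {for t, continuous G}.
    by apply: continuousN; exact: continuous_expRN.
  have within_cont h : (forall t : R, 0 < t -> {for t, continuous h}) ->
      {within `[n.+1%:R^-1, n.+2%:R], continuous (h : R -> R)}.
    move=> ch; apply: continuous_in_subspaceT => t; rewrite inE /= => ht.
    by apply: ch; exact: gt0.
  transitivity (\int[mu]_(t in exhaustion n) (F t * g t)%:E)%E.
    by apply: eq_integral => t _; rewrite /euler_integrand addrK.
  rewrite /exhaustion (@integration_by_parts R F G f g _ _ ab); first last.
  - move=> t _; rewrite /G derive1E deriveN //; rewrite -derive1E derive1_comp //.
    by rewrite derive1N // derive1_id derive1E derive_val /= mulrN1 opprK.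
  - split.
    + by move=> t _; exact: ex_derive.
    + by apply: cvg_at_right_filter; exact: cG.
    + by apply: cvg_at_left_filter; exact: cG.
  - by apply: within_cont => t _; exact: continuous_expRN.
  - move=> t /oo_gt0 t0; by apply: (@powR_derive1 R x); rewrite in_itv /= t0.
  - split.
    + by move=> t /oo_gt0 t0; apply: derivable_powR; rewrite in_itv /= t0.
    + by apply: cvg_at_right_filter; apply: cF.
    + by apply: cvg_at_left_filter; apply: cF; rewrite ltr0n.
  - apply: within_cont => t t0; apply: continuousM; first exact: cst_continuous.
    exact: continuous_powR.
  under eq_integral => t _.
    rewrite (_ : f t * G t = - (x * euler_integrand x t)); last first.
      by rewrite /f /G /euler_integrand mulrN mulrA.
    rewrite EFinN.
    over.
  have xe0 t : (0 <= (x * euler_integrand x t)%:E)%E.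
    by rewrite lee_fin mulr_ge0 ?euler_integrand_ge0 // ltW.
  rewrite integral_ge0N //= oppeK -/(B n); congr (_ + _)%E.
  under eq_integral do rewrite EFinM.
  rewrite ge0_integralZl //=.
  - exact: measurable_euler_integrand.
  - by move=> t _; rewrite lee_fin euler_integrand_ge0.
  - by rewrite lee_fin ltW.
have B0 : (B n)%:E @[n --> \oo] --> (0%:E : \bar R).
  apply: cvg_EFin; first exact: nearW.
  rewrite (_ : fine \o _ = fun n => - (n.+2%:R `^ x * expR (- n.+2%:R))
    + n.+1%:R^-1 `^ x * expR (- n.+1%:R^-1)); last first.
    by apply/funext => n /=; rewrite /B /F /G !mulrN opprK.
  rewrite -[X in _ --> X]addr0 -{1}oppr0.
  by apply: cvgD; [apply: cvgN; exact: cvg_powR_expRN|exact: cvg_powRV_expRN].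
have /cvg_lim <- // := @cvg_ext_euler_integral (x + 1).
apply/cvg_lim => //.
rewrite [X in X @ _ --> _](funext step) -[X in _ --> X]add0e.
apply: cvgeD => //.
by apply: cvgeZl => //; exact: cvg_ext_euler_integral.
Qed.

Lemma ext_euler_integral1 : ext_euler_integral 1 = 1%E.
Proof.
rewrite /ext_euler_integral integral_itv_obnd_cbnd; last first.
  exact: measurable_euler_integrand.
have e1 t : euler_integrand 1 t = expR (- t).
  by rewrite /euler_integrand subrr powRr0 mul1r.
rewrite (@ge0_continuous_FTC2y _ _ (fun t => - expR (- t)) _ 0)//.
- by rewrite oppr0 expR0 EFinN oppeK add0e.
- by move=> t _; rewrite euler_integrand_ge0.
- apply: continuous_in_subspaceT => t _.
  rewrite (_ : euler_integrand 1 = fun t => expR (- t)); last exact/funext.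
  exact: continuous_expRN.
- by rewrite -oppr0; apply: cvgN; exact: cvgr_expR.
- by apply: cvgN; apply/cvg_at_right_filter; exact: continuous_expRN.
- move=> t _; rewrite derive1E deriveN //; rewrite -derive1E derive1_comp //.
  by rewrite derive1N // derive1_id derive1E derive_val /= mulrN1 opprK e1.
Qed.

Lemma ext_euler_integral_nat m : ext_euler_integral m.+1%:R = (m`!%:R)%:E.
Proof.
elim: m => [|m IH]; first by rewrite ext_euler_integral1.
rewrite -natr1 ext_euler_integralS ?ltr0n // IH -EFinM -natrM.
by rewrite factS.
Qed.

(** The functional equation reduces the claim to x + 1 >= 1, where the
    integrand lies below the sum of those at 1 and at an integer beyond x + 1;
    these two integrals are factorials. *)
Lemma ext_euler_integral_fin x : 0 < x -> ext_euler_integral x \is a fin_num.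
Proof.
move=> x0.
(* Euler's integral at x is the one at x + 1 divided by x. *)
suff: ext_euler_integral (x + 1) \is a fin_num.
  rewrite ext_euler_integralS //.
  have := ext_euler_integral_ge0 x.
  by case: (ext_euler_integral x) => [r||] //= _; rewrite mulry gtr0_sg // mul1e.
pose m := (Num.truncn x).+1.
rewrite ge0_fin_numE ?ext_euler_integral_ge0 //.
apply: (@le_lt_trans _ _ (ext_euler_integral 1 + ext_euler_integral m.+1%:R)%E);
  last by rewrite ext_euler_integral1 ext_euler_integral_nat -EFinD ltry.
rewrite /ext_euler_integral -ge0_integralD //=; first last.
- exact: measurable_euler_integrand.
- by move=> t _; rewrite lee_fin euler_integrand_ge0.
- exact: measurable_euler_integrand.
- by move=> t _; rewrite lee_fin euler_integrand_ge0.
apply: ge0_le_integral => //=.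
- by move=> t _; rewrite lee_fin euler_integrand_ge0.
- exact: measurable_euler_integrand.
- by apply: emeasurable_funD; exact: measurable_euler_integrand.
move=> t; rewrite in_itv /= andbT => t0; rewrite -EFinD lee_fin.
rewrite /euler_integrand -mulrDl ler_wpM2r ?expR_ge0 // addrK subrr powRr0.
have [t1|/ltW t1] := leP t 1.
  apply: (@le_trans _ _ 1); last by rewrite lerDl powR_ge0.
  have h1 : 1 `^ x = 1 :> R by rewrite powR1.
  by rewrite -[leRHS]h1; apply: ge0_ler_powR; rewrite ?nnegrE // ltW.
apply: (@le_trans _ _ (t `^ (m.+1%:R - 1))); last by rewrite lerDr.
by apply: ler_powR => //; rewrite -natr1 addrK; exact/ltW/truncnS_gt.
Qed.

Lemma euler_integralS x : 0 < x -> euler_integral (x + 1) = x * euler_integral x.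
Proof.
move=> x0; rewrite !euler_integralE ext_euler_integralS //.
by rewrite fineM // ext_euler_integral_fin.
Qed.

(** After one use of the functional equation the power t^x is at least 1 on [1,
    2], which bounds the integral below. *)
Lemma euler_integral_gt0 x : 0 < x -> 0 < euler_integral x.
Proof.
move=> x0; suff: 0 < euler_integral (x + 1).
  by rewrite euler_integralS // pmulr_rgt0.
rewrite euler_integralE fine_gt0 //; apply/andP; split; last first.
  by rewrite -ge0_fin_numE ?ext_euler_integral_ge0 // ext_euler_integral_fin // ltr_wpDl // ltW.
apply: (@lt_le_trans _ _ (\int[mu]_(t in `[1%R, 2%R]) (cst (expR (- 2))%:E t))%E).
  rewrite integral_cst //= lebesgue_measure_itv /= lte_fin ltr1n -EFinD -EFinM lte_fin.
  by rewrite mulr_gt0 ?expR_gt0 // subr_gt0 ltr1n.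
apply: (@le_trans _ _ (\int[mu]_(t in `[1%R, 2%R]) (euler_integrand (x + 1) t)%:E)%E).
  apply: ge0_le_integral => //=.
  - exact: measurable_euler_integrand.
  move=> t; rewrite in_itv /= => /andP[t1 t2]; rewrite lee_fin /euler_integrand addrK.
  rewrite -[leLHS]mul1r; apply: ler_pM; rewrite ?expR_ge0 //.
    by rewrite -(powRr0 t) ler_powR // ltW.
  by rewrite ler_expR lerN2.
apply: ge0_subset_integral => //=.
- exact: measurable_euler_integrand.
- by move=> t _; rewrite lee_fin euler_integrand_ge0.
- move=> t /=; rewrite !in_itv /= andbT => /andP[t1 _]; exact: lt_le_trans t1.
Qed.

End EulerIntegral.

Section GammaFunction.
Variable R : realType.
Implicit Types (y : R).

(** For negative y the number m of shifts used by the definition drops by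
    exactly one from y to y + 1, so both sides evaluate Euler's integral at the
    same point. *)
Lemma GammaS y : ~ nonpos_integer y -> Gamma (y + 1) = y * Gamma y.
Proof.
move=> hy; have y0 : y != 0 by apply/eqP => y0; apply: hy; exists 0%N; rewrite y0 oppr0.
rewrite /Gamma; have [yp|] := ltP 0 y.
  rewrite ltr_wpDl ?(ltW yp) // !addr0 euler_integralS //.
  by rewrite /rising !big_ord0 !divr1.
rewrite le_eqVlt (negPf y0) /= => yn.
set m := Num.truncn (- y).
have Ny0 : 0 <= - y by rewrite oppr_ge0 ltW.
have /andP[m1 m2] := truncn_itv Ny0; rewrite -/m in m1 m2.
case: ifP => y1.
  have m0 : m = 0%N.
    apply/eqP; rewrite -leqn0 -ltnS -(ltr_nat R); apply: le_lt_trans m1 _.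
    by rewrite ltrNl -subr_gt0 opprK.
  rewrite m0 addr0 /rising big_ord0 divr1 big_ord_recl big_ord0 /= addr0 mulr1.
  by rewrite mulrC divfK.
set m' := Num.truncn (- (y + 1)).
have y1' : 0 <= - (y + 1) by rewrite oppr_ge0 leNgt y1.
have mE : m = m'.+1.
  apply: truncn_def; have /andP[] := truncn_itv y1'.
  by rewrite -/m' -(lerD2r 1) -(ltrD2r 1) !natr1 opprD subrK => -> ->.
rewrite mE [in RHS]risingSl (_ : y + 1 + m'.+1%:R = y + m'.+2%:R).
  by rewrite invfM mulrCA [y * _]mulrA mulrV ?unitfE // mul1r.
by rewrite -addrA nat1r.
Qed.

Lemma Gamma_neq0 y : ~ nonpos_integer y -> Gamma y != 0.
Proof.
move=> hy; rewrite /Gamma mulf_neq0 //; last first.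
  by rewrite invr_eq0 rising_neq0.
rewrite gt_eqF // euler_integral_gt0 //; case: ifP => [|/negbT]; first by rewrite addr0.
by rewrite -leNgt => y0; rewrite -ltrBlDl sub0r truncnS_gt.
Qed.

Lemma Gamma_rising y n : ~ nonpos_integer y -> Gamma (y + n%:R) = rising y n * Gamma y.
Proof.
move=> hy; elim: n => [|n IH]; first by rewrite addr0 rising0 mul1r.
rewrite -natr1 addrA GammaS; last by move=> /nonpos_integerD.
by rewrite IH risingSr mulrCA mulrA.
Qed.

End GammaFunction.

(** * Polynomial families with one member in each degree *)

Section GradedBasis.
Variable R : realType.
Variable e : nat -> {poly R}.
Hypothesis size_e : forall j, size (e j) = j.+1.
Implicit Types (p : {poly R}) (n : nat).

Lemma size_graded_sum (f : nat -> R) n : f n != 0 ->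
  size (\sum_(j < n.+1) f j *: e j) = n.+1.
Proof.
move=> fn; have sn : size (f n *: e n) = n.+1 by rewrite size_scale ?size_e.
rewrite big_ord_recr /= addrC size_polyDl sn //.
rewrite ltnS; apply: leq_trans (size_sum _ _ _) _; apply/bigmax_leqP => i _.
by apply: leq_trans (size_scale_leq _ _) _; rewrite size_e.
Qed.

Lemma lead_coef_graded n : lead_coef (e n) = (e n)`_n.
Proof. by rewrite lead_coefE size_e. Qed.

(** One step of Euclidean elimination against the member of degree n. *)
Lemma size_graded_sub p n : (size p <= n.+1)%N ->
  (size (p - (p`_n / lead_coef (e n)) *: e n)%R <= n)%N.
Proof.
move=> sp; apply/leq_sizeP => i; rewrite leq_eqVlt => /predU1P[<-|ni].
  rewrite coefB coefZ -lead_coef_graded divfK ?subrr //.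
  by rewrite lead_coef_eq0 -size_poly_eq0 size_e.
have pi0 : p`_i = 0 by rewrite nth_default // (leq_trans sp).
by rewrite coefB coefZ pi0 [(e n)`_i]nth_default ?size_e // mulr0 subrr.
Qed.

Lemma graded_functional_eq0 (psi : {scalar {poly R}}) n :
  (forall j, (j < n)%N -> psi (e j) = 0) ->
  forall p, (size p <= n)%N -> psi p = 0.
Proof.
elim: n => [|n IH] psi0 p sp.
  by move: sp; rewrite leqn0 size_poly_eq0 => /eqP ->; rewrite linear0.
rewrite -[X in psi X](subrK ((p`_n / lead_coef (e n)) *: e n)) linearD [X in _ + X]linearZ /=.
rewrite psi0 // mulr0 addr0; apply: IH; last exact: size_graded_sub.
by move=> j jn; apply: psi0; exact: ltnW.
Qed.

Lemma graded_functionalE (psi : {scalar {poly R}}) n :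
  (forall j, (j < n)%N -> psi (e j) = 0) ->
  forall p, (size p <= n.+1)%N -> psi p = p`_n / lead_coef (e n) * psi (e n).
Proof.
move=> psi0 p sp; apply/eqP; rewrite -subr_eq0 -linearZ -linearB /=.
by rewrite (graded_functional_eq0 psi0) // size_graded_sub.
Qed.

End GradedBasis.

(** * The Hahn operator and its eigenfunctions *)

Section ShiftOperators.
Variable R : realType.
Implicit Types (p q : {poly R}) (l : int).

Lemma shiftp_is_linear l : linear (shiftp (R := R) l).
Proof. by move=> a p q; rewrite /shiftp comp_polyD comp_polyZ. Qed.

HB.instance Definition _ l :=
  GRing.isLinear.Build R {poly R} {poly R} _ (shiftp l) (shiftp_is_linear l).

Lemma shiftpM l p q : shiftp l (p * q) = shiftp l p * shiftp l q.
Proof. exact: rmorphM. Qed.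

Lemma shiftp_rising l (p : {poly R}) n : shiftp l (rising p n) = rising (shiftp l p) n.
Proof.
rewrite /rising /shiftp rmorph_prod; apply: eq_bigr => i _ /=.
by rewrite rmorphD /= rmorph_nat.
Qed.

End ShiftOperators.

(** Both operators that occur act on the basis (-x)_j by such a two-term rule,
    so an identity between their values reduces to one between coefficients j
    and j + 1. *)
Lemma bidiagonal_sum (R : realType) (V : lmodType R) (U : {linear V -> V}) (b : nat -> V)
    (d e f : nat -> R) (n : nat) :
  U (b 0) = d 0 *: b 0 -> (forall j, U (b j.+1) = d j.+1 *: b j.+1 - e j *: b j) ->
  f n.+1 = 0 ->
  U (\sum_(j < n.+1) f j *: b j) = \sum_(j < n.+1) (f j * d j - f j.+1 * e j) *: b j.
Proof.
move=> U0 US fn; rewrite linear_sum.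
under [RHS]eq_bigr => j _ do rewrite scalerBl.
rewrite sumrB [X in _ - X]big_ord_recr /= fn mul0r scale0r addr0.
rewrite big_ord_recl linearZ /= U0 scalerA [X in X - _]big_ord_recl -addrA; congr (_ + _).
rewrite -sumrB; apply: eq_bigr => j _.
by rewrite lift0 linearZ /= US scalerBr !scalerA.
Qed.

Section HahnPolynomials.
Variable R : realType.
Variables alpha c N : R.
Local Notation T := (hahn_op alpha c N).
Local Notation b := (rising (- 'X : {poly R})).

Lemma hahn_op_is_linear : linear T.
Proof.
by move=> a p q; rewrite /hahn_op !shiftp_is_linear -!mul_polyC; ring.
Qed.

HB.instance Definition _ :=
  GRing.isLinear.Build R {poly R} {poly R} _ T hahn_op_is_linear.

Lemma shiftp_b1 n : shiftp 1 (b n.+1) = - ('X + 1) * b n.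
Proof.
rewrite shiftp_rising /shiftp rmorphN /= comp_polyX risingSl mulr1z.
by rewrite opprD subrK.
Qed.

Lemma X_shiftp_bN1 n : 'X * shiftp (-1) (b n) = - b n.+1.
Proof.
rewrite shiftp_rising /shiftp rmorphN /= comp_polyX risingSl mulrN1z.
by rewrite opprD polyCN opprK mulNr opprK.
Qed.

Lemma shiftp0 p : shiftp (R := R) 0 p = p.
Proof. by rewrite /shiftp mulr0z addr0 comp_polyXr. Qed.

(** The operator is bidiagonal in the basis of the polynomials (-x)_j: this is
    why its eigenfunctions have closed hypergeometric coefficients. *)
Lemma hahn_op_b0 : T (b 0) = (alpha + c - N - 1) *: b 0.
Proof.
rewrite /hahn_op rising0 /shiftp comp_polyC -mul_polyC; ring.
Qed.

(** The operator is bidiagonal in the basis of the polynomials (-x)_j: this is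
    why its eigenfunctions have closed hypergeometric coefficients. *)
Lemma hahn_op_b n : T (b n.+1) =
  theta alpha c N n.+1 *: b n.+1 - (n.+1%:R * (n%:R + c) * (n.+1%:R - N)) *: b n.
Proof.
rewrite /hahn_op shiftp_b1 shiftp0 mulrAC X_shiftp_bN1 !risingSr -!mul_polyC /theta -nat1r.
ring.
Qed.

(** The operator (N - 1 - x) Delta is bidiagonal in the same basis, with the
    same direction. *)
Lemma lowering_b n :
  (- 'X + N%:P - 1) * Delta (b n.+1) = - n.+1%:R *: b n.+1 - (n.+1%:R * (N - n.+1%:R)) *: b n.
Proof.
rewrite /Delta shiftp_b1 !risingSr -!mul_polyC -nat1r.
ring.
Qed.


Definition hahn_coef n j : R :=
  rising (- n%:R) j * rising (1 - N + j%:R) (n - j) * rising (c + j%:R) (n - j)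
    / (rising (n%:R + alpha + c - N + j%:R) (n - j) * (j`!)%:R).

(** The factor (-n)_j vanishes, whatever the truncated exponent n - j does to
    the others; sums over j may thus be extended freely. *)
Lemma hahn_coef_small n j : (n < j)%N -> hahn_coef n j = 0.
Proof.
by move=> nj; rewrite /hahn_coef rising_opp_nat ffact_small // mulr0 !mul0r.
Qed.

Lemma hahn_coefnn n : hahn_coef n n = (-1) ^+ n.
Proof.
rewrite /hahn_coef rising_opp_nat ffactnn subnn !rising0 !mulr1 mul1r mulfK //.
Qed.

Lemma hahnE M n : (n < M)%N -> hahn alpha c N n = \sum_(j < M) hahn_coef n j *: b j.
Proof.
move=> nM; rewrite /hahn (big_ord_widen M (fun j => hahn_coef n j *: b j)) // big_mkcond /=.
by apply: eq_bigr => j _; case: ltnP => // nj; rewrite hahn_coef_small ?scale0r.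
Qed.

Lemma hahn0 : hahn alpha c N 0 = 1.
Proof. by rewrite /hahn big_ord1 -/(hahn_coef 0 0) hahn_coefnn scale1r rising0. Qed.

Hypothesis a1_nonpole : ~ nonpos_integer (alpha + c - N + 1).

Lemma hahn_denom_neq0 n j : rising (n%:R + alpha + c - N + j%:R) (n - j) != 0.
Proof.
case: n => [|n]; first by rewrite rising0 oner_neq0.
have -> : n.+1%:R + alpha + c - N + j%:R = alpha + c - N + 1 + (n + j)%:R.
  by rewrite natrD -nat1r; ring.
by apply: rising_neq0 => /nonpos_integerD.
Qed.

Lemma fact_neq0 n : n`!%:R != 0 :> R.
Proof. by rewrite pnatr_eq0 -lt0n fact_gt0. Qed.

(** The coefficients satisfy the first order recurrence that a bidiagonal
    operator imposes on an eigenvector. It is stated without division because j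
    + 1 = N or j = -c may occur. *)
Lemma hahn_coef_step n j :
  hahn_coef n j.+1 * (j.+1%:R * (j.+1%:R - N) * (j%:R + c)) =
  hahn_coef n j * ((j%:R - n%:R) * (n%:R + alpha + c - N + j%:R)).
Proof.
have [jn|nj] := ltnP j n; last first.
  rewrite hahn_coef_small // mul0r; move: nj; rewrite leq_eqVlt => /predU1P[->|nj].
    by rewrite subrr mul0r mulr0.
  by rewrite hahn_coef_small // mul0r.
rewrite /hahn_coef.
have := hahn_denom_neq0 n j; have := hahn_denom_neq0 n j.+1.
rewrite -(subnSK jn) (risingSr (- n%:R) j) !risingSl factS natrM.
have -> : 1 - N + j%:R + 1 = 1 - N + j.+1%:R by rewrite -nat1r; ring.
have -> : c + j%:R + 1 = c + j.+1%:R by rewrite -nat1r; ring.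
have -> : n%:R + alpha + c - N + j%:R + 1 = n%:R + alpha + c - N + j.+1%:R by rewrite -nat1r; ring.
rewrite mulf_eq0 negb_or => h1 /andP[h2 _].
have h3 := fact_neq0 j; have h4 : j.+1%:R != 0 :> R by rewrite pnatr_eq0.
rewrite -nat1r in h1 h2 h4 *.
by field; rewrite h1 h2 h3 h4.
Qed.

(** By the coefficient recurrence, since theta_n - theta_j = (n - j) (n + j +
    alpha + c - N). *)
Theorem hahn_op_eigen n : T (hahn alpha c N n) = theta alpha c N n *: hahn alpha c N n.
Proof.
rewrite (hahnE (ltnSn n)).
rewrite (@bidiagonal_sum _ _ _ _ (theta alpha c N)
  (fun j => j.+1%:R * (j%:R + c) * (j.+1%:R - N)) (hahn_coef n)) //; first last.
- exact: hahn_coef_small.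
- exact: hahn_op_b.
- by rewrite [LHS]hahn_op_b0 /theta add0r mul1r add0r.
rewrite scaler_sumr; apply: eq_bigr => j _; rewrite scalerA; congr (_ *: _).
have := hahn_coef_step n j.
rewrite /theta -nat1r; set C := hahn_coef n j.+1 => h.
have -> : C * ((1 + j%:R) * (j%:R + c) * (1 + j%:R - N)) = C * ((1 + j%:R) * (1 + j%:R - N) * (j%:R + c)) by ring.
rewrite h; ring.
Qed.

End HahnPolynomials.

(** * Contiguity of Hahn polynomials in the parameter c *)

Section Contiguity.
Variable R : realType.
Variables alpha c N : R.
Local Notation a := (alpha + c - N).
Local Notation b := (rising (- 'X : {poly R})).

(** The factor of beta_n that does not involve the dual Hahn polynomial: beta_n
    is this number times gamma_(n+1) / gamma_n. *)
Definition contiguity_coef n : R :=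
  n%:R * (N - n%:R) * (n%:R + alpha - N)
    / ((2 * n%:R + alpha + c - N - 1) * (2 * n%:R + alpha + c - N - 2)).

Hypothesis a_neq0 : a != 0.
Hypothesis a1_nonpole : ~ nonpos_integer (a + 1).

Lemma a_nonpole : ~ nonpos_integer (alpha + (c - 1) - N + 1).
Proof.
have -> : alpha + (c - 1) - N + 1 = a by ring.
move=> [[|m] e]; first by move: a_neq0; rewrite e oppr0 eqxx.
by apply: a1_nonpole; exists m; rewrite e -nat1r; ring.
Qed.

Lemma addan_neq0 n : a + n%:R != 0.
Proof.
have -> : a = alpha + (c - 1) - N + 1 by ring.
exact: (addn_neq0 _ a_nonpole).
Qed.

Lemma contiguity_denom1 m : 2 * m.+1%:R + alpha + c - N - 1 != 0.
Proof.
have -> : 2 * m.+1%:R + alpha + c - N - 1 = a + (2 * m + 1)%:R.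
  by rewrite natrD natrM -nat1r; ring.
exact: addan_neq0.
Qed.

Lemma contiguity_denom2 m : 2 * m.+1%:R + alpha + c - N - 2 != 0.
Proof.
have -> : 2 * m.+1%:R + alpha + c - N - 2 = a + (2 * m)%:R.
  by rewrite natrM -nat1r; ring.
exact: addan_neq0.
Qed.

Lemma rising_oppS m j : (j <= m)%N ->
  rising (- m.+1%:R) j = m.+1%:R * rising (- m%:R) j / (m.+1%:R - j%:R) :> R.
Proof.
move=> jm; have nz : m.+1%:R - j%:R != 0 :> R.
  by rewrite subr_eq0 eqr_nat gtn_eqF.
have := risingSl (- m.+1%:R : R) j; rewrite risingSr.
have -> : - m.+1%:R + 1 = - m%:R :> R by rewrite -nat1r; ring.
move=> h; apply: (mulIf nz); rewrite divfK //.
by rewrite -[RHS]opprK -mulNr -h; ring.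
Qed.

(** All coefficients of degree m + 1 are expressed through those of degree m;
    with the next lemma the contiguity relation becomes a rational identity
    with a common factor. *)
Lemma hahn_coefS m j : (j <= m)%N ->
  hahn_coef alpha c N m.+1 j = hahn_coef alpha c N m j *
   (m.+1%:R * (1 - N + m%:R) * (c + m%:R) * (m%:R + a + j%:R) /
    ((m.+1%:R - j%:R) * (2 * m%:R + a) * (2 * m%:R + 1 + a))).
Proof.
move=> jm; have nz : m.+1%:R - j%:R != 0 :> R.
  by rewrite subr_eq0 eqr_nat gtn_eqF.
rewrite /hahn_coef subSn // rising_oppS //.
rewrite (risingSr (1 - N + j%:R)) (risingSr (c + j%:R)).
have e1 : m%:R + a + j%:R != 0.
  by rewrite addrAC -natrD addrC; exact: addan_neq0.
have e2 : 2 * m%:R + a != 0.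
  by rewrite -natrM addrC; exact: addan_neq0.
have e3 : 2 * m%:R + 1 + a != 0.
  by rewrite -natrM natr1 addrC; exact: addan_neq0.
have e4 : rising (m%:R + alpha + c - N + j%:R) (m - j) != 0 by exact: hahn_denom_neq0.
have -> : rising (m.+1%:R + alpha + c - N + j%:R) (m - j).+1 =
   rising (m%:R + alpha + c - N + j%:R) (m - j) * (2 * m%:R + a) * (2 * m%:R + 1 + a) / (m%:R + a + j%:R).
  apply: (mulIf e1); rewrite divfK //.
  have -> : m%:R + a + j%:R = m%:R + alpha + c - N + j%:R by ring.
  have -> : m.+1%:R + alpha + c - N + j%:R = m%:R + alpha + c - N + j%:R + 1 by rewrite -nat1r; ring.
  rewrite mulrC -risingSl !risingSr -[(m - j).+1%:R]nat1r natrB //.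
  ring.
have e5 := fact_neq0 R j.
rewrite natrB // -nat1r in nz *.
by field; rewrite nz e1 e2 e3 e4 e5.
Qed.

(** All coefficients of degree m + 1 are expressed through those of degree m;
    with the next lemma the contiguity relation becomes a rational identity
    with a common factor. *)
Lemma hahn_coefS_shift m j : (j <= m)%N ->
  hahn_coef alpha (c - 1) N m.+1 j = hahn_coef alpha c N m j *
   (m.+1%:R * (1 - N + m%:R) * (c - 1 + j%:R) /
    ((m.+1%:R - j%:R) * (2 * m%:R + a))).
Proof.
move=> jm; have nz : m.+1%:R - j%:R != 0 :> R.
  by rewrite subr_eq0 eqr_nat gtn_eqF.
rewrite /hahn_coef subSn // rising_oppS //.
rewrite (risingSr (1 - N + j%:R)) (risingSl (c - 1 + j%:R)).
have -> : c - 1 + j%:R + 1 = c + j%:R by ring.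
have e2 : 2 * m%:R + a != 0.
  by rewrite -natrM addrC; exact: addan_neq0.
have e4 : rising (m%:R + alpha + c - N + j%:R) (m - j) != 0 by exact: hahn_denom_neq0.
have -> : rising (m.+1%:R + alpha + (c - 1) - N + j%:R) (m - j).+1 =
   rising (m%:R + alpha + c - N + j%:R) (m - j) * (2 * m%:R + a).
  have -> : m.+1%:R + alpha + (c - 1) - N + j%:R = m%:R + alpha + c - N + j%:R by rewrite -nat1r; ring.
  by rewrite risingSr natrB //; congr (_ * _); ring.
have e5 := fact_neq0 R j.
rewrite natrB // -nat1r in nz *.
by field; rewrite nz e2 e4 e5.
Qed.

Lemma contiguity_coefE m : contiguity_coef m.+1 =
  - (m.+1%:R * (1 - N + m%:R) * (m%:R + 1 + alpha - N)) / ((2 * m%:R + 1 + a) * (2 * m%:R + a)).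
Proof.
rewrite /contiguity_coef; congr (_ / (_ * _)); rewrite -nat1r; ring.
Qed.

Lemma hahn_coef_contiguous m j :
  hahn_coef alpha c N m.+1 j + contiguity_coef m.+1 * hahn_coef alpha c N m j =
  hahn_coef alpha (c - 1) N m.+1 j.
Proof.
have [jm|] := leqP j m; last first.
  rewrite leq_eqVlt => /predU1P[<-|mj].
    by rewrite !hahn_coefnn (@hahn_coef_small _ _ _ _ m) // mulr0 addr0.
  by rewrite !hahn_coef_small // ?mulr0 ?addr0 // ltnW.
rewrite hahn_coefS // hahn_coefS_shift // contiguity_coefE.
have nz : m.+1%:R - j%:R != 0 :> R.
  by rewrite subr_eq0 eqr_nat gtn_eqF.
have e2 : 2 * m%:R + a != 0.
  by rewrite -natrM addrC; exact: addan_neq0.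
have e3 : 2 * m%:R + 1 + a != 0.
  by rewrite -natrM natr1 addrC; exact: addan_neq0.
move: (hahn_coef _ _ _ _ _) => C.
rewrite -nat1r in nz *.
by field; rewrite nz e2 e3.
Qed.

(** For k = 0 this is the whole statement: lowering c by one amounts to adding
    a multiple of the previous polynomial. *)
Lemma hahn_contiguous m :
  hahn alpha c N m.+1 + contiguity_coef m.+1 *: hahn alpha c N m = hahn alpha (c - 1) N m.+1.
Proof.
rewrite !(@hahnE _ _ _ _ m.+2) ?ltnS ?leqnSn // scaler_sumr -big_split /=.
by apply: eq_bigr => j _; rewrite scalerA -scalerDl hahn_coef_contiguous.
Qed.

End Contiguity.

(** * The eigenvalue equation of the higher order operator *)

Section PolynomialOfOperator.
Variable R : realType.
Variable T : {linear {poly R} -> {poly R}}.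
Implicit Types P p q : {poly R}.

Lemma poly_op_is_linear P : linear (poly_op P T).
Proof.
move=> a p q; rewrite /poly_op scaler_sumr -big_split; apply: eq_bigr => j _ /=.
suff -> : iter j T (a *: p + q) = a *: iter j T p + iter j T q.
  by rewrite scalerDr !scalerA mulrC.
by elim: (nat_of_ord j) => //= i ->; rewrite linearP.
Qed.

HB.instance Definition _ P :=
  GRing.isLinear.Build R {poly R} {poly R} _ (poly_op P T) (poly_op_is_linear P).

(** A polynomial in an operator multiplies an eigenvector by the value of the
    polynomial at the eigenvalue. *)
Lemma poly_op_eigen P p x : T p = x *: p -> poly_op P T p = P.[x] *: p.
Proof.
move=> Tp; rewrite /poly_op horner_coef scaler_suml; apply: eq_bigr => j _.
rewrite -scalerA; congr (_ *: _).
by elim: (nat_of_ord j) => [|i /= ->]; rewrite ?scale1r // linearZ /= Tp scalerA exprSr.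
Qed.

End PolynomialOfOperator.

Section Lowering.
Variable R : realType.
Variables alpha c N : R.
Local Notation a := (alpha + c - N).

Definition lowering (p : {poly R}) : {poly R} := (- 'X + N%:P - 1) * Delta p.

Lemma lowering_is_linear : linear lowering.
Proof. by move=> x p q; rewrite /lowering /Delta shiftp_is_linear -!mul_polyC; ring. Qed.

HB.instance Definition _ :=
  GRing.isLinear.Build R {poly R} {poly R} _ lowering lowering_is_linear.

Hypothesis a_neq0 : a != 0.
Hypothesis a1_nonpole : ~ nonpos_integer (a + 1).
Hypothesis c1_nonpole : ~ nonpos_integer (c - 1).

(** Multiplying by c - 1 + j, which never vanishes, makes the coefficient
    recurrence for c - 1 applicable to the term of index j + 1; what remains is
    a rational identity. *)
Lemma lowering_coef m j :
  hahn_coef alpha (c - 1) N m.+1 j * (- j%:R)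
    - hahn_coef alpha (c - 1) N m.+1 j.+1 * (j.+1%:R * (N - j.+1%:R)) =
  - m.+1%:R * hahn_coef alpha c N m.+1 j
    + (m%:R + a) * contiguity_coef alpha c N m.+1 * hahn_coef alpha c N m j.
Proof.
have step := hahn_coef_step (a_nonpole a_neq0 a1_nonpole) m.+1 j.
have cj : c - 1 + j%:R != 0 by exact: addn_neq0.
have := hahn_coef_contiguous a_neq0 a1_nonpole m j => /(canRL (addrK _)) ->.
apply: (mulfI cj).
set C' := hahn_coef _ _ _ _ j in step *; set C'' := hahn_coef _ _ _ _ j.+1 in step *.
set C := hahn_coef _ _ _ m j; set e := contiguity_coef _ _ _ _.
transitivity ((c - 1 + j%:R) * (C' * (- j%:R)) + C'' * (j.+1%:R * (j.+1%:R - N) * (j%:R + (c - 1)))); first by ring.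
rewrite step.
(* The relation between consecutive degrees left after eliminating the index
   j + 1; both sides vanish for j > m. *)
suff h : (m.+1%:R - j%:R) * (m.+1%:R + alpha - N) * C' = - (c - 1 + j%:R) * (2 * m%:R + 1 + a) * e * C.
  apply/eqP; rewrite -subr_eq0; apply/eqP.
  transitivity (- ((m.+1%:R - j%:R) * (m.+1%:R + alpha - N) * C') - (c - 1 + j%:R) * (2 * m%:R + 1 + a) * e * C).
    by rewrite -nat1r; ring.
  by rewrite h; ring.
rewrite /C' /C /e; have [jm|] := leqP j m; last first.
  rewrite leq_eqVlt => /predU1P[<-|mj].
    by rewrite subrr !mul0r hahn_coef_small // mulr0.
  by rewrite !hahn_coef_small ?mulr0 // ltnW.
rewrite hahn_coefS_shift // contiguity_coefE.
have nz : m.+1%:R - j%:R != 0 :> R by rewrite subr_eq0 eqr_nat gtn_eqF.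
have e2 : 2 * m%:R + a != 0.
  by rewrite -natrM addrC; exact: addan_neq0.
have e3 : 2 * m%:R + 1 + a != 0.
  by rewrite -natrM natr1 addrC; exact: addan_neq0.
move: (hahn_coef _ _ _ _ _) => X.
rewrite -nat1r in nz *.
by field; rewrite nz e2 e3.
Qed.

(** On a single Hahn polynomial the operator (N - 1 - x) Delta produces terms
    of every lower degree; on the contiguous combination all but two of them
    cancel. This is the mechanism that makes the operator D bispectral. *)
Lemma lowering_hahn m :
  lowering (hahn alpha (c - 1) N m.+1) =
  - m.+1%:R *: hahn alpha c N m.+1
    + ((m%:R + a) * contiguity_coef alpha c N m.+1) *: hahn alpha c N m.
Proof.
rewrite !(@hahnE _ _ _ _ m.+2) ?ltnS ?leqnSn //.
rewrite (@bidiagonal_sum _ _ _ _ (fun j => - j%:R)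
  (fun j => j.+1%:R * (N - j.+1%:R)) (hahn_coef alpha (c - 1) N m.+1)) //; first last.
- exact: hahn_coef_small.
- exact: lowering_b.
- rewrite /= /lowering /Delta rising0 /shiftp comp_polyC subrr mulr0.
  by rewrite oppr0 scale0r.
rewrite !scaler_sumr -big_split; apply: eq_bigr => j _ /=.
by rewrite !scalerA -scalerDl lowering_coef.
Qed.

End Lowering.

Section DualHahn.
Variable R : realType.
Variables (k : nat) (alpha c N : R).
Local Notation a := (alpha + c - N).
Local Notation theta := (theta alpha c N).
Local Notation sigma := (sigma alpha c N).
Local Notation gamma := (gamma k alpha c N).
Local Notation P1 := (P1 k alpha c N).
Local Notation P2 := (P2 k alpha c N).

Lemma gammaS m : gamma m.+1 = P2.[theta m].
Proof. by rewrite /gamma /theta /P2; congr (_.[_]); rewrite -nat1r; ring. Qed.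

(** On the lattice theta_m each factor of r_j splits into two linear factors.
    *)
Lemma dual_basis_theta j m :
  (dual_basis alpha c N j).[theta m] = rising (m%:R + 1) j * rising (1 - m%:R - a) j.
Proof.
elim: j => [|j IH].
  by rewrite /dual_basis big_ord0 scale1r hornerC !rising0 mulr1.
rewrite /dual_basis big_ord_recr exprS -scalerA scalerAl hornerZ /= hornerM.
rewrite -/(dual_basis alpha c N j) IH !hornerE /= !risingSr /theta.
ring.
Qed.

(** The relation between P1 and P2, for one basis polynomial r_j: its two
    summands are weighted by 1 / j! and 1 / (j + 1)!. *)
Lemma dual_basis_difference j m :
  let r i := (dual_basis alpha c N j).[theta i] in
  (a * j.+1%:R + 2 * (theta m.+1 - (a - 1))) * r m.+1
    - (a * j.+1%:R + 2 * (theta m - (a - 1))) * r m =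
  j.+1%:R * (sigma m.+2 * r m.+1 + sigma m.+1 * r m).
Proof.
rewrite /= !dual_basis_theta /theta /sigma -[m.+2%:R]nat1r.
case: j => [|j]; first by rewrite !rising0 -!nat1r; ring.
have -> : 1 - m.+1%:R - a = - m%:R - a by rewrite -nat1r; ring.
rewrite (risingSr (m.+1%:R + 1)) (risingSl (m%:R + 1)) (risingSl (- m%:R - a)) (risingSr (1 - m%:R - a)).
have -> : - m%:R - a + 1 = 1 - m%:R - a by ring.
have -> : m.+1%:R + 1 = m%:R + 1 + 1 :> R by rewrite -nat1r; ring.
rewrite -[m.+1%:R]nat1r -[j.+2%:R]nat1r -[j.+1%:R]nat1r.
move: (rising _ _) (rising _ _) => Y Z; ring.
Qed.

(** P1 is a discrete primitive of P2 along the eigenvalues theta; this is how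
    P1 enters the eigenvalue equation. *)
Lemma P1_difference m :
  P1.[theta m.+1] - P1.[theta m] = sigma m.+2 * gamma m.+2 + sigma m.+1 * gamma m.+1.
Proof.
rewrite !gammaS.
have P1E x : P1.[x] = \sum_(j < k.+1) dual_coef k alpha c j / (j.+1`!)%:R *
   ((a * j.+1%:R + 2 * (x - (a - 1))) * (dual_basis alpha c N j).[x]).
  rewrite /P1 /dual_hahn hornerD hornerZ hornerM hornerZ !horner_sum !mulr_sumr -big_split.
  apply: eq_bigr => j _ /=; rewrite !(hornerZ, hornerXsubC).
  rewrite factS natrM; have h1 := fact_neq0 R j; have h2 : j.+1%:R != 0 :> R by rewrite pnatr_eq0.
  by rewrite -nat1r in h2 *; field; rewrite h1 h2.
have P2E x : P2.[x] = \sum_(j < k.+1) dual_coef k alpha c j / (j.+1`!)%:R *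
   (j.+1%:R * (dual_basis alpha c N j).[x]).
  rewrite /P2 /dual_hahn horner_sum.
  apply: eq_bigr => j _ /=; rewrite !(hornerZ, hornerXsubC).
  rewrite factS natrM; have h1 := fact_neq0 R j; have h2 : j.+1%:R != 0 :> R by rewrite pnatr_eq0.
  by rewrite -nat1r in h2 *; field; rewrite h1 h2.
rewrite !P1E !P2E !mulr_sumr -sumrB -big_split; apply: eq_bigr => j _ /=.
rewrite -mulrBr dual_basis_difference; ring.
Qed.

Hypothesis a_neq0 : a != 0.
Hypothesis a1_nonpole : ~ nonpos_integer (a + 1).
Hypothesis c1_nonpole : ~ nonpos_integer (c - 1).
Hypothesis gamma_neq0 : forall n, gamma n != 0.

(** Since gamma_(n+1) = P2(theta_n), applying P2 of the Hahn operator to q_n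
    turns the weight beta_n into the contiguity coefficient and yields a
    multiple of the Hahn polynomial with parameter c - 1. The lowering operator
    then gives a combination of the two original Hahn polynomials, and the
    difference equation of P1 makes the two coefficients proportional to those
    of q_n. *)
Theorem D_op_eigen n :
  D_op k alpha c N (q k alpha c N n) = lambda k alpha c N n *: q k alpha c N n.
Proof.
rewrite /D_op -/(lowering N _).
case: n => [|m].
  have T1 : hahn_op alpha c N 1 = theta 0 *: 1 by rewrite -(hahn0 alpha c N) hahn_op_eigen.
  rewrite /= !(poly_op_eigen _ T1) [lowering N _]linearZ /=.
  have -> : lowering N 1 = 0 by rewrite /lowering /Delta /shiftp comp_polyC subrr mulr0.
  rewrite scaler0 addr0 !scalerA -scalerDl; congr (_ *: _).
  by rewrite /sigma; ring.
set h := hahn alpha c N m.+1; set h' := hahn alpha c N m.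
set e := contiguity_coef alpha c N m.+1.
have betaE : beta k alpha c N m.+1 = e * (gamma m.+2 / gamma m.+1) by [].
have opE P : poly_op P (hahn_op alpha c N) (q k alpha c N m.+1) =
    P.[theta m.+1] *: h + (beta k alpha c N m.+1 * P.[theta m]) *: h'.
  rewrite /q addrC [LHS]linearP /=.
  by rewrite !(poly_op_eigen _ (hahn_op_eigen a1_nonpole _)) scalerA addrC.
have P2q : poly_op P2 (hahn_op alpha c N) (q k alpha c N m.+1) =
    gamma m.+2 *: hahn alpha (c - 1) N m.+1.
  rewrite opE -!gammaS -hahn_contiguous // scalerDr !scalerA betaE.
  by rewrite -mulrA divfK // (mulrC e).
rewrite P2q opE [lowering N _]linearZ /= lowering_hahn // -hahn_contiguous //.
rewrite -/h -/h' -/e /lambda /q -/h -/h' betaE.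
have := P1_difference m => /(canRL (subrK _)) ->.
rewrite /sigma -[m.+2%:R]nat1r -[m.+1%:R]nat1r.
set g2 := gamma m.+2; set g1 := gamma m.+1; set p1 := P1.[_].
have g1n0 : g1 != 0 by exact: gamma_neq0.
have -> : g2 = (g2 / g1) * g1 by rewrite divfK.
rewrite mulfK //; move: (g2 / g1) => g.
have collect (u v w x y z t : R) :
    u *: ((w *: h) + x *: h') + (v *: (y *: (h + e *: h')) + y *: (z *: h + t *: h')) =
    (u * w + v * y + y * z) *: h + (u * x + v * y * e + y * t) *: h'.
  by rewrite -!mul_polyC; ring.
rewrite collect scalerDr scalerA; by congr (_ *: _ + _ *: _); field.
Qed.

End DualHahn.

(** * Genre and order of the operator *)

Section BandedOperators.
Variable R : realType.
Implicit Types (p f bot top : {poly R}) (T U : {poly R} -> {poly R}).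

(** Only the two extreme coefficients are recorded: they alone decide the
    genre, and they follow simple rules under the operations that build D. The
    coefficients themselves are allowed to vanish, which lets operators of
    different width be added after widening. *)
Definition banded T (s : int) (d : nat) bot top : Prop :=
  exists g : nat -> {poly R}, [/\ g 0%N = bot, g d = top &
    forall p, T p = \sum_(i < d.+1) g i * shiftp (s + i%:Z) p].

Lemma bandedW T U s d bot top bot' top' :
  banded T s d bot top -> T =1 U -> bot = bot' -> top = top' -> banded U s d bot' top'.
Proof.
by move=> [g [g0 gd gE]] TU <- <-; exists g; split=> // p; rewrite -TU gE.
Qed.

Lemma bandedD T U s d b1 b2 t1 t2 : banded T s d b1 t1 -> banded U s d b2 t2 ->
  banded (fun p => T p + U p) s d (b1 + b2) (t1 + t2).
Proof.
move=> [g [g0 gd gE]] [h [h0 hd hE]]; exists (fun i => g i + h i).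
split; rewrite ?g0 ?h0 ?gd ?hd // => p.
by rewrite gE hE -big_split; apply: eq_bigr => i _; rewrite mulrDl.
Qed.

Lemma bandedM f T s d b t : banded T s d b t ->
  banded (fun p => f * T p) s d (f * b) (f * t).
Proof.
move=> [g [g0 gd gE]]; exists (fun i => f * g i).
split; rewrite ?g0 ?gd // => p.
by rewrite gE mulr_sumr; apply: eq_bigr => i _; rewrite mulrA.
Qed.

Lemma bandedZ (x : R) T s d b t : banded T s d b t ->
  banded (fun p => x *: T p) s d (x *: b) (x *: t).
Proof.
move=> hT; apply: bandedW (bandedM x%:P hT) _ _ _ => [p||]; exact: mul_polyC.
Qed.

Lemma shiftpD l m p : shiftp l (shiftp m p) = shiftp (R := R) (l + m) p.
Proof.
rewrite /shiftp -comp_polyA; congr (_ \Po _).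
by rewrite comp_polyD comp_polyX comp_polyC -addrA -polyCD -intrD.
Qed.

Lemma banded_shift l T s d b t : banded T s d b t ->
  banded (fun p => shiftp l (T p)) (l + s) d (shiftp l b) (shiftp l t).
Proof.
move=> [g [g0 gd gE]]; exists (fun i => shiftp l (g i)).
split; rewrite ?g0 ?gd // => p; rewrite gE linear_sum /=; apply: eq_bigr => i _.
by rewrite shiftpM shiftpD addrA.
Qed.

Lemma banded_widenr T s d b t : banded T s d b t -> banded T s d.+1 b 0.
Proof.
move=> [g [g0 gd gE]]; exists (fun i => if i == d.+1 then 0 else g i).
split; rewrite ?eqxx // => p.
rewrite big_ord_recr /= eqxx mul0r addr0 gE; apply: eq_bigr => i _ /=.
by rewrite ltn_eqF.
Qed.

Lemma banded_widenl T s d b t : banded T s d b t -> banded T (s - 1) d.+1 0 t.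
Proof.
move=> [g [g0 gd gE]]; exists (fun i => if i is j.+1 then g j else 0).
split=> // p; rewrite big_ord_recl mul0r add0r gE; apply: eq_bigr => i _ /=.
by rewrite lift0 -subrA subr0 || rewrite /= /bump /= add1n intS addrA subrK.
Qed.

Lemma banded_has_genre T s d b t : b != 0 -> t != 0 -> banded T s d b t ->
  has_genre T s (s + d%:Z).
Proof.
move=> b0 t0 [g [g0 gd gE]]; split; first by rewrite lerDl.
exists (fun l => g `|(l - s)%R|%N).
have sK (i : nat) : `|(s + i%:Z - s)%R|%N = i by rewrite addrC addKr.
split; rewrite ?subrr ?sK ?g0 ?gd // => p; rewrite gE.
by apply: eq_bigr => i _; rewrite sK.
Qed.

Lemma size_shiftp l p : size (shiftp (R := R) l p) = size p.
Proof. by rewrite /shiftp size_comp_poly2 // size_XaddC. Qed.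

Lemma shiftp_eq0 l p : (shiftp (R := R) l p == 0) = (p == 0).
Proof. by rewrite -!size_poly_eq0 size_shiftp. Qed.

End BandedOperators.

Section HahnOperatorBand.
Variable R : realType.
Variables alpha c N : R.
Local Notation T := (hahn_op alpha c N).

Fixpoint low_coef j : {poly R} :=
  if j is i.+1 then 'X * ('X - alpha%:P) * shiftp (-1) (low_coef i) else 1.

Fixpoint high_coef j : {poly R} :=
  if j is i.+1 then ('X + c%:P) * ('X - N%:P + 1) * shiftp 1 (high_coef i) else 1.

Lemma low_coef_neq0 j : low_coef j != 0.
Proof.
elim: j => [|j IH] /=; first exact: oner_neq0.
by rewrite !mulf_neq0 ?polyX_eq0 ?polyXsubC_eq0 ?shiftp_eq0.
Qed.

(** The exact degree is needed, and not only that the polynomial is nonzero: at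
    the top shift of D two contributions meet, and they are separated by
    degree. *)
Lemma size_high_coef j : size (high_coef j) = (2 * j).+1.
Proof.
elim: j => [|j IH] /=; first by rewrite size_polyC oner_neq0.
have -> : 'X - N%:P + 1 = 'X + (1 - N)%:P :> {poly R} by rewrite polyCB; ring.
have nz x : 'X + x%:P != 0 :> {poly R} by rewrite -size_poly_eq0 size_XaddC.
have h0 : shiftp 1 (high_coef j) != 0 by rewrite -size_poly_eq0 size_shiftp IH.
rewrite !size_mul ?mulf_neq0 // !size_XaddC size_shiftp IH /=; lia.
Qed.

(** The three shifts of the Hahn operator move the band by -1, 0 and 1; each
    extreme of the result receives a single contribution. *)
Lemma banded_hahn_op U s d b t : banded U s d b t ->
  banded (fun p => T (U p)) (s - 1) d.+2
    ('X * ('X - alpha%:P) * shiftp (-1) b) (('X + c%:P) * ('X - N%:P + 1) * shiftp 1 t).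
Proof.
move=> hU.
have h1 := banded_widenr (banded_widenr (banded_shift (-1) hU)).
have h2 := banded_widenl (banded_widenr (banded_shift 0 hU)).
have h3 := banded_widenl (banded_widenl (banded_shift 1 hU)).
rewrite [-1 + s]addrC in h1; rewrite add0r in h2.
rewrite (_ : 1 + s - 1 - 1 = s - 1) in h3; last by rewrite [1 + s]addrC addrK.
apply: bandedW (bandedD (bandedD (bandedM _ h1) (bandedM _ h2)) (bandedM _ h3)) _ _ _.
- by move=> p; rewrite /hahn_op.
- by rewrite !mulr0 !addr0.
- by rewrite !mulr0 !add0r.
Qed.

Lemma banded_iter j : banded (iter j T) (- j%:Z) (2 * j) (low_coef j) (high_coef j).
Proof.
elim: j => [|j IH].
  by exists (fun=> 1); split=> // p; rewrite big_ord1 mul1r shiftp0.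
have := banded_hahn_op IH; rewrite mulnS add2n.
by rewrite (_ : - j%:Z - 1 = - j.+1%:Z) // intS opprD addrC.
Qed.

Lemma banded_poly_op (P : {poly R}) d : size P = d.+1 ->
  banded (poly_op P T) (- d%:Z) (2 * d)
    (lead_coef P *: low_coef d) (lead_coef P *: high_coef d).
Proof.
move=> sP.
have h n : banded (fun p => \sum_(j < n.+1) P`_j *: iter j T p) (- n%:Z) (2 * n)
    (P`_n *: low_coef n) (P`_n *: high_coef n).
  elim: n => [|n IH].
    apply: bandedW (bandedZ P`_0 (banded_iter 0)) _ _ _ => // p.
    by rewrite big_ord1.
  have := banded_widenl (banded_widenr IH).
  rewrite (_ : - n%:Z - 1 = - n.+1%:Z); last by rewrite intS opprD addrC.
  rewrite (_ : (2 * n).+2 = (2 * n.+1)%N); last by lia.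
  move=> h; apply: bandedW (bandedD h (bandedZ P`_n.+1 (banded_iter n.+1))) _ _ _.
  - by move=> p; rewrite [RHS]big_ord_recr.
  - by rewrite add0r.
  - by rewrite add0r.
apply: bandedW (h d) _ _ _; rewrite ?lead_coefE ?sP //.
by move=> p; rewrite /poly_op sP.
Qed.

End HahnOperatorBand.

Section Genre.
Variable R : realType.
Variables (k : nat) (alpha c N : R).
Local Notation P1 := (P1 k alpha c N).
Local Notation P2 := (P2 k alpha c N).

Lemma size_dual_basis j : size (dual_basis alpha c N j) = j.+1.
Proof.
rewrite /dual_basis size_scale ?signr_eq0 //.
elim: j => [|j IH]; first by rewrite big_ord0 size_polyC oner_neq0.
by rewrite big_ord_recr /= size_mul -?size_poly_eq0 ?IH ?size_XaddC ?addn2.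
Qed.

Lemma dual_coef_last_neq0 : dual_coef k alpha c k != 0.
Proof.
rewrite /dual_coef subnn !rising0 !mulr1 rising_opp_nat mulf_neq0 ?signr_eq0 //.
by rewrite pnatr_eq0 -lt0n ffactnn fact_gt0.
Qed.

Lemma size_P2 : size P2 = k.+1.
Proof.
apply: (@size_graded_sum _ _ size_dual_basis (fun j => dual_coef k alpha c j / j`!%:R)).
by rewrite mulf_neq0 ?dual_coef_last_neq0 // invr_eq0 fact_neq0.
Qed.

Lemma size_P1 : size P1 = k.+2.
Proof.
have two_neq0 : 2 != 0 :> R by rewrite pnatr_eq0.
rewrite /P1; set S := \sum_(j < k.+1) _; have sS : size S = k.+1.
  apply: (@size_graded_sum _ _ size_dual_basis (fun j => dual_coef k alpha c j / j.+1`!%:R)).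
  by rewrite mulf_neq0 ?dual_coef_last_neq0 // invr_eq0 fact_neq0.
have sXS : size (2 *: ('X - (alpha + c - N - 1)%:P) * S) = k.+2.
  rewrite -scalerAl size_scale // size_mul ?polyXsubC_eq0 -?size_poly_eq0 ?sS //.
  by rewrite size_XsubC.
rewrite addrC size_polyDl sXS // ltnS.
by apply: leq_trans (size_scale_leq _ _) _; rewrite -/P2 size_P2.
Qed.

(** At the bottom only P1 of the Hahn operator contributes. At the top there is
    also a term from the lowering operator, of degree 2k + 1 against 2k + 2. *)
Theorem D_op_genre : has_genre (D_op k alpha c N) (- k.+1%:Z) k.+1%:Z.
Proof.
have b1 := banded_poly_op alpha c N size_P1.
have b2 := banded_poly_op alpha c N size_P2.
have widen l T s d b t : banded (R := R) T s d b t -> l = s - 1 -> banded T l d.+2 0 0.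
  by move=> h ->; apply: banded_widenl (banded_widenr h).
have b2w := widen _ _ _ _ _ _ b2 erefl.
have b2s := banded_widenl (banded_widenl (banded_shift 1 b2)).
have e1 : - k%:Z - 1 = - k.+1%:Z by rewrite intS opprD addrC.
have e2 : 1 - k%:Z - 1 - 1 = - k.+1%:Z by rewrite -e1; ring.
have e3 : (2 * k).+2 = (2 * k.+1)%N by lia.
rewrite e1 e3 in b2w; rewrite e2 e3 in b2s.
have bL := bandedM (- 'X + N%:P - 1) (bandedD b2s (bandedZ (-1) b2w)).
have bD := bandedD (bandedZ 2^-1 b1) (bandedD (bandedZ (- ((alpha + c - N) / 2)) b2w) bL).
rewrite !(scaler0, addr0, mulr0, add0r) in bD.
have DE : D_op k alpha c N =1 fun p => 2^-1 *: poly_op P1 (hahn_op alpha c N) p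
    + (- ((alpha + c - N) / 2) *: poly_op P2 (hahn_op alpha c N) p
      + (- 'X + N%:P - 1) * (shiftp 1 (poly_op P2 (hahn_op alpha c N) p)
          + -1 *: poly_op P2 (hahn_op alpha c N) p)).
  by move=> p; rewrite /D_op /Delta scaleN1r.
have := bandedW bD (fsym DE) erefl erefl => /banded_has_genre.
have -> : - k.+1%:Z + (2 * k.+1)%:Z = k.+1%:Z by lia.
have half_neq0 : 2^-1 != 0 :> R by rewrite invr_eq0 pnatr_eq0.
have lead1 : lead_coef P1 != 0 by rewrite lead_coef_eq0 -size_poly_eq0 size_P1.
apply.
  by rewrite !scaler_eq0 (negPf half_neq0) (negPf lead1) low_coef_neq0.
have sA : size (2^-1 *: (lead_coef P1 *: high_coef c N k.+1)) = (2 * k.+1).+1.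
  by rewrite !size_scale ?size_high_coef.
rewrite -size_poly_eq0 size_polyDl sA //.
apply: leq_ltn_trans (size_polyMleq _ _) _.
rewrite size_shiftp.
have s1 : size (- 'X + N%:P - 1 : {poly R}) = 2.
  have -> : - 'X + N%:P - 1 = - ('X - (N - 1)%:P) :> {poly R} by rewrite polyCB; ring.
  by rewrite size_polyN size_XsubC.
rewrite s1 add2n /= ltnS; apply: leq_ltn_trans (size_scale_leq _ _) _.
by rewrite size_high_coef; lia.
Qed.

Theorem D_op_order : has_order (D_op k alpha c N) (2 * k + 2).
Proof.
by exists (- k.+1%:Z), k.+1%:Z; split; [exact: D_op_genre|lia].
Qed.

End Genre.

(** * Orthogonality read off from factorial moments *)

Section HahnMoments.
Variable R : realType.
Local Notation b := (rising (- 'X : {poly R})).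

(** Both kinds of Hahn functional are captured by this predicate. The sequence
    v plays the role of s |-> 1 / Gamma (alpha + c - N + 1 + s) up to a
    constant; describing it by its recurrence read downwards keeps the case
    where its first values vanish, which does occur for positive integers N. *)
Definition hahn_moments (alpha c N : R) (phi : {scalar {poly R}}) (v : nat -> R) :=
  (forall s, v s = (alpha + c - N + 1 + s%:R) * v s.+1) /\
  (forall i, phi (b i) = rising (1 - N) i * rising c i * v i).

Lemma size_rising_sub (x : R) j : size (rising (x%:P - 'X) j) = j.+1.
Proof.
elim: j => [|j IH]; first by rewrite rising0 size_polyC oner_neq0.
have s1 : size (x%:P - 'X + j%:R : {poly R}) = 2.
  have -> : x%:P - 'X + j%:R = - ('X - (x + j%:R)%:P) :> {poly R}.
    by rewrite polyCD polyC_natr; ring.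
  by rewrite size_polyN size_XsubC.
by rewrite risingSr size_mul -?size_poly_eq0 ?IH ?s1 ?addn2.
Qed.

Lemma size_rising_X j : size (b j) = j.+1.
Proof. by have := size_rising_sub 0 j; rewrite polyC0 sub0r. Qed.

Section Fixed.
Variables alpha c N : R.
Local Notation a := (alpha + c - N).

(** Multiplying a Hahn weight by (x + c)_j raises c by j, hence the closed
    form. The proof only uses (x + c + j) = (i + j + c) - (i - x). *)
Lemma hahn_moments_plus phi v i j : hahn_moments alpha c N phi v ->
  phi (b i * rising ('X + c%:P) j) =
  rising (1 - N) i * rising c (i + j) * rising (alpha + c) j * v (i + j)%N.
Proof.
move=> [vS mom]; elim: j i => [|j IH] i.
  by rewrite !rising0 !mulr1 addn0 mom.
have -> : b i * rising ('X + c%:P) j.+1 =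
    (i%:R + j%:R + c) *: (b i * rising ('X + c%:P) j) - b i.+1 * rising ('X + c%:P) j.
  by rewrite !risingSr -mul_polyC; ring.
rewrite linearB linearZ /= !IH addSn addnS !risingSr (vS (i + j)%N) natrD.
ring.
Qed.

(** Here the factor (alpha - x)_j raises alpha by j. Testing against these
    polynomials is what makes the orthogonality sums summable by
    Chu-Vandermonde. *)
Lemma hahn_moments_minus phi v i j : hahn_moments alpha c N phi v ->
  phi (b i * rising (alpha%:P - 'X) j) =
  rising (1 - N) i * rising c i * rising (alpha + c) j * rising (alpha + 1 - N) j
    * v (i + j)%N.
Proof.
move=> [vS mom]; elim: j i => [|j IH] i.
  by rewrite !rising0 !mulr1 addn0 mom.
have -> : b i * rising (alpha%:P - 'X) j.+1 =
    (alpha + j%:R - i%:R) *: (b i * rising (alpha%:P - 'X) j) + b i.+1 * rising (alpha%:P - 'X) j.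
  by rewrite !risingSr -mul_polyC; ring.
rewrite linearD linearZ /= !IH addSn addnS !risingSr (vS (i + j)%N) natrD.
ring.
Qed.

(** The Christoffel transform by (x + c)_s of a Hahn functional is a Hahn
    functional with parameter c + s. *)
Lemma hahn_moments_shift phi v s : hahn_moments alpha c N phi v ->
  hahn_moments alpha (c + s%:R) N (mul_functional (rising ('X + c%:P) s) phi)
    (fun i => rising c s * rising (alpha + c) s * v (s + i)%N).
Proof.
move=> hphi; split=> i.
  by rewrite addnS (proj1 hphi (s + i)%N) natrD; ring.
rewrite /= /mul_functional mulrC (hahn_moments_plus _ _ hphi) addnC risingD; ring.
Qed.

Hypothesis a1_nonpole : ~ nonpos_integer (a + 1).

Lemma size_hahn n : size (hahn alpha c N n) = n.+1.
Proof.
rewrite (hahnE alpha c N (ltnSn n)).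
by apply: (size_graded_sum size_rising_X); rewrite hahn_coefnn signr_eq0.
Qed.

(** A Gauss sum: the summand equals, up to a constant factor, the one of
    Chu-Vandermonde with b = n + a and d = a + 1 + j. *)
Lemma hahn_coef_sum n j :
  \sum_(i < n.+1) hahn_coef alpha c N n i *
     (rising (1 - N) i * rising c i / rising (a + 1) (i + j)) =
  rising (1 - N) n * rising c n * rising (1 + j%:R - n%:R) n /
    (rising (n%:R + a) n * rising (a + 1) (n + j)).
Proof.
have -> : 1 + j%:R - n%:R = (a + 1 + j%:R) - (n%:R + a) by ring.
rewrite -(Vandermonde_alternating n (n%:R + a) (a + 1 + j%:R)) mulr_sumr mulr_suml; apply: eq_bigr => i _.
have le_in : (i <= n)%N by rewrite -ltnS.
rewrite /hahn_coef rising_opp_nat -bin_ffact natrM.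
have splt x : rising x n = rising x i * rising (x + i%:R) (n - i) :> R.
  by rewrite -risingD subnKC.
have e1 : rising (n%:R + a + i%:R) (n - i) != 0.
  by have := hahn_denom_neq0 a1_nonpole n i; rewrite !addrA.
have e2 : rising (n%:R + a) i != 0.
  apply/negP => /eqP e; have := hahn_denom_neq0 a1_nonpole n 0.
  by rewrite addr0 subn0 -!addrA (addrA alpha) splt e mul0r eqxx.
have e3 := rising_neq0 (i + j) a1_nonpole.
have e4 := rising_neq0 (n + j) a1_nonpole.
have e5 := fact_neq0 R i.
have eD : rising (a + 1) (n + j) = rising (a + 1) (i + j) * rising (a + 1 + j%:R + i%:R) (n - i).
  rewrite (_ : a + 1 + j%:R + i%:R = a + 1 + (i + j)%:R) ?natrD; last by ring.
  by rewrite -natrD -risingD; congr rising; lia.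
have e6 : rising (a + 1 + j%:R + i%:R) (n - i) != 0.
  by move: e4; rewrite eD mulf_eq0 negb_or => /andP[].
have dE : n%:R + alpha + c - N + i%:R = n%:R + a + i%:R by ring.
rewrite dE (splt (1 - N)) (splt c) (splt (n%:R + a)) eD.
by field; rewrite e1 e2 e3 e5 e6.
Qed.

Lemma hahn_moments_rising phi v s : hahn_moments alpha c N phi v ->
  v s = v 0%N / rising (a + 1) s.
Proof.
move=> [vS _]; elim: s => [|s IH]; first by rewrite rising0 divr1.
have h1 : a + 1 + s%:R != 0 := addn_neq0 s a1_nonpole.
have h2 := rising_neq0 s a1_nonpole.
apply: (mulfI h1); rewrite -vS IH risingSr; by field; rewrite h1 h2.
Qed.

Lemma hahn_moments_test phi v n j : hahn_moments alpha c N phi v ->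
  phi (hahn alpha c N n * rising (alpha%:P - 'X) j) =
  v 0%N * rising (alpha + c) j * rising (alpha + 1 - N) j *
  (rising (1 - N) n * rising c n * rising (1 + j%:R - n%:R) n /
    (rising (n%:R + a) n * rising (a + 1) (n + j))).
Proof.
move=> hphi; rewrite (hahnE alpha c N (ltnSn n)) mulr_suml linear_sum -hahn_coef_sum mulr_sumr.
apply: eq_bigr => i _ /=.
rewrite -scalerAl linearZ /= (hahn_moments_minus _ _ hphi) (hahn_moments_rising _ hphi).
ring.
Qed.

(** The factor (1 + j - n)_n of the sum vanishes exactly for j < n. *)
Lemma hahn_orthogonal phi v n (p : {poly R}) : hahn_moments alpha c N phi v ->
  (size p <= n)%N -> phi (hahn alpha c N n * p) = 0.
Proof.
move=> hphi; apply: (graded_functional_eq0 (size_rising_sub alpha)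
  (psi := mul_functional (hahn alpha c N n) phi)) => j jn.
rewrite /= /mul_functional (hahn_moments_test _ _ hphi).
suff -> : rising (1 + j%:R - n%:R) n = 0 :> R by rewrite mulr0 mul0r mulr0.
rewrite (_ : 1 + j%:R - n%:R = - (n - j.+1)%:R); last by rewrite natrB // -nat1r; ring.
by rewrite rising_opp_nat ffact_small ?mulr0 //; lia.
Qed.

(** Only the leading coefficient of the test polynomial matters, so the power
    is traded for (alpha - x)_n, against which the value is a product. *)
Lemma hahn_norm_neq0 phi v n : hahn_moments alpha c N phi v -> v 0%N != 0 ->
  ~ nonpos_integer (alpha - N + 1) -> ~ nonpos_integer (alpha + c) ->
  ~ nonpos_integer c -> rising (1 - N) n != 0 ->
  phi (hahn alpha c N n * 'X^n) != 0.
Proof.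
move=> hphi v0 h1 h2 h3 h4.
have psi0 j : (j < n)%N -> phi (hahn alpha c N n * rising (alpha%:P - 'X) j) = 0.
  by move=> jn; apply: hahn_orthogonal hphi _; rewrite size_rising_sub.
have /= := graded_functionalE (size_rising_sub alpha)
  (psi := mul_functional (hahn alpha c N n) phi) psi0 (p := 'X^n).
rewrite size_polyXn => /(_ (leqnn _)); rewrite /mul_functional => ->.
rewrite (hahn_moments_test _ _ hphi) coefXn eqxx mul1r addrK.
rewrite -[n in rising 1 n](add0n n).
have e1 : rising (n%:R + a) n != 0.
  by have := hahn_denom_neq0 a1_nonpole n 0; rewrite addr0 subn0 -!addrA.
have e2 : rising (alpha + 1 - N) n != 0.
  by rewrite (_ : alpha + 1 - N = alpha - N + 1); [exact: rising_neq0|ring].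
have e3 : rising 1 n != 0 :> R.
  by apply: rising_neq0 => -[m e]; have : (0 : R) < 1 := ltr01; rewrite e oppr_gt0 ltrn0.
rewrite !mulf_neq0 ?invr_eq0 ?mulf_neq0 // ?rising_neq0 //.
by rewrite lead_coef_eq0 -size_poly_eq0 size_rising_sub.
Qed.

End Fixed.
End HahnMoments.

(** * The perturbed functional and its orthogonal polynomials *)

Section AdjointLadder.
Variable R : realType.
Variables alpha c' N : R.
Variable phi : {scalar {poly R}}.
Variable v : nat -> R.
Hypothesis hphi : hahn_moments alpha c' N phi v.
Local Notation b := (rising (- 'X : {poly R})).

(** Multiplied by (x + c')_(t+1), the functional of parameter c' is formally
    that of parameter c divided by (x + c - 1) ... (x + c - j - 1). The adjoint
    of the Hahn operator moves along this ladder, and the number subtracted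
    from it is the eigenvalue theta_n at n = - j - 1. *)
Lemma ladder_rising t j i (c := c' + t%:R + j%:R + 2) (a := alpha + c - N) :
  phi ((hahn_op alpha c N (b i) + (j%:R * (a - 2 - j%:R)) *: b i) * rising ('X + c'%:P) t.+1) =
  j.+1%:R * (c' + t%:R) * (alpha + c' + t%:R) * phi (b i * rising ('X + c'%:P) t).
Proof.
have vS := proj1 hphi.
have phiZ x p : phi (x *: p) = x * phi p by rewrite linearZ.
case: i => [|i].
  rewrite hahn_op_b0 -scalerDl -scalerAl linearZ /= !(hahn_moments_plus _ _ hphi).
  rewrite !add0n !risingSr !rising0 (vS t) /a /c -nat1r; ring.
rewrite hahn_op_b addrAC -scalerDl mulrBl -!(@scalerAl _ {poly R}) linearB !phiZ.
rewrite !(hahn_moments_plus _ _ hphi) !addSn addnS !risingSr.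
rewrite (vS (i + t).+1) /theta /a /c -[i.+1%:R]nat1r -[(i + t).+1%:R]nat1r natrD -[j.+1%:R]nat1r; ring.
Qed.

Lemma ladder_hahn t j n (c := c' + t%:R + j%:R + 2) (a := alpha + c - N) :
  ~ nonpos_integer (a + 1) ->
  (theta alpha c N n + j%:R * (a - 2 - j%:R)) *
    phi (hahn alpha c N n * rising ('X + c'%:P) t.+1) =
  j.+1%:R * (c' + t%:R) * (alpha + c' + t%:R) * phi (hahn alpha c N n * rising ('X + c'%:P) t).
Proof.
move=> a1_nonpole; have h := hahn_op_eigen a1_nonpole n.
rewrite -linearZ /= scalerAl scalerDl -h (hahnE alpha c N (ltnSn n)).
rewrite linear_sum scaler_sumr -big_split !mulr_suml !linear_sum mulr_sumr /=.
apply: eq_bigr => i _.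
set C := hahn_coef _ _ _ _ _.
have phiZ x p : phi (x *: p) = x * phi p by rewrite linearZ.
have -> : hahn_op alpha c N (C *: b i) + (j%:R * (a - 2 - j%:R)) *: (C *: b i) =
    C *: (hahn_op alpha c N (b i) + (j%:R * (a - 2 - j%:R)) *: b i).
  by rewrite scalerDr linearZ /= !scalerA [C * _]mulrC.
by rewrite -!(@scalerAl _ {poly R}) !phiZ ladder_rising mulrCA.
Qed.

End AdjointLadder.

Section KrallOrthogonality.
Variable R : realType.
Variables (k : nat) (alpha c N : R).
Local Notation a := (alpha + c - N).
Local Notation c' := (c - k%:R - 1).
Local Notation theta := (theta alpha c N).
Local Notation gamma := (gamma k alpha c N).
Local Notation hahn := (hahn alpha c N).
Local Notation e := (rising ('X + c'%:P)).

Hypothesis a1_nonpole : ~ nonpos_integer (a + 1).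
Hypothesis aN_nonpole : ~ nonpos_integer (alpha - N + 1).
Hypothesis ac_nonpole : ~ nonpos_integer (alpha + c - k%:R - 1).
Hypothesis c'_nonpole : ~ nonpos_integer c'.
Hypothesis a_neq0 : a != 0.
Hypothesis gamma_neq0 : forall n, gamma n != 0.

Variable phi : {scalar {poly R}}.
Variable v : nat -> R.
Hypothesis hphi : hahn_moments alpha c' N phi v.
Hypothesis vk_neq0 : v k.+1 != 0.

Lemma ac'_nonpole : ~ nonpos_integer (alpha + c').
Proof. by rewrite !addrA. Qed.

Lemma c1_nonpole : ~ nonpos_integer (c - 1).
Proof.
by rewrite (_ : c - 1 = c' + k%:R); [move=> /nonpos_integerD|ring].
Qed.

Lemma c_nonpole : ~ nonpos_integer c.
Proof. by rewrite (_ : c = c - 1 + 1%:R); [move=> /nonpos_integerD /c1_nonpole|ring]. Qed.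

Lemma acc_nonpole : ~ nonpos_integer (alpha + c).
Proof.
by rewrite (_ : alpha + c = alpha + c' + k.+1%:R); [move=> /nonpos_integerD /ac'_nonpole|rewrite -nat1r; ring].
Qed.

(** The factors of r_j are the successive steps of the ladder. *)
Lemma dual_basis_link n j : (j <= k)%N ->
  (dual_basis alpha c N j).[theta n] * phi (hahn n * e k) =
  (-1) ^+ j * j`!%:R * rising (2 - c) j * rising (2 - alpha - c) j * phi (hahn n * e (k - j)).
Proof.
elim: j => [|j IH] jk.
  by rewrite /dual_basis big_ord0 scale1r hornerC subn0 !rising0 !mulr1.
have := IH (ltnW jk).
have -> : (dual_basis alpha c N j.+1).[theta n] =
    - (theta n + j%:R * (a - 2 - j%:R)) * (dual_basis alpha c N j).[theta n].
  rewrite /dual_basis big_ord_recr exprS -scalerA scalerAl hornerZ /= hornerM.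
  by rewrite !(hornerD, hornerX, hornerC); ring.
rewrite -(mulrA (- _)) => ->.
have ct : c' + (k - j.+1)%:R + j%:R + 2 = c by rewrite natrB // -nat1r; ring.
have := @ladder_hahn _ alpha c' N phi v hphi (k - j.+1) j n.
rewrite /= ct subnSK // => /(_ a1_nonpole) h.
rewrite !risingSr exprS factS natrM.
have -> : forall x y z w u t : R, - x * (y * z * w * u * t) = - (y * z * w * u * (x * t)).
  by move=> *; ring.
rewrite h natrB // -[j.+1%:R]nat1r; ring.
Qed.

(** Dividing by the constant, this says that the perturbed functional is the
    Hahn functional of parameter c - 1 composed with P2 of the Hahn operator.
    The constant completes each coefficient of the dual Hahn polynomial to full
    rising factorials, and what is left is the expansion of (x + c' + 1)_k. *)
Theorem dual_hahn_link n :
  gamma n.+1 * phi (hahn n * e k) =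
  rising (2 - c) k * rising (2 - alpha - c) k
    * phi (hahn n * rising ('X + (c - k%:R)%:P) k).
Proof.
have -> : 'X + (c - k%:R)%:P = 'X + c'%:P + 1 :> {poly R} by rewrite [in RHS]polyCB; ring.
rewrite rising_shift1 !mulr_sumr linear_sum mulr_sumr /= gammaS /P2 /dual_hahn horner_sum mulr_suml.
rewrite (reindex_inj rev_ord_inj) /=; apply: eq_bigr => t _.
rewrite subSS; have tk : (t <= k)%N by rewrite -ltnS.
rewrite hornerZ -(mulrA (_ / _)) dual_basis_link ?leq_subr // subKn //.
rewrite /dual_coef rising_opp_nat subKn //.
have phiN p i : phi (i%:R * p) = i%:R * phi p by rewrite mulr_natl linearMn /= mulr_natl.
rewrite (mulrCA (hahn n)) phiN.
have s2 : (-1) ^+ (k - t) * (-1) ^+ (k - t) = 1 :> R by rewrite -exprMn mulrNN mulr1 expr1n.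
have splt x : rising x k = rising x (k - t) * rising (x + (k - t)%:R) t :> R.
  by rewrite -risingD subnK.
rewrite !splt.
have fn := fact_neq0 R (k - t).
set s := (-1) ^+ (k - t) in s2 *.
transitivity (s * s * (rising (2 - c) (k - t) * rising (2 - c + (k - t)%:R) t *
    (rising (2 - alpha - c) (k - t) * rising (2 - alpha - c + (k - t)%:R) t) *
    ((k ^_ (k - t))%:R * phi (hahn n * e t)))); last by rewrite s2 mul1r.
by field.
Qed.

Let mu : {scalar {poly R}} := mul_functional (rising ('X + (c - k%:R)%:P) k) phi.
Let rho : {scalar {poly R}} := mul_functional (e k.+1) phi.

(** The perturbed functional is a Geronimus transform: times x + c' it becomes
    a Hahn functional of parameter c. *)
Lemma mu_mulXc p : mu (('X + c'%:P) * p) = rho p.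
Proof.
rewrite /mu /rho /= /mul_functional risingSl; congr (phi _).
have -> : 'X + (c - k%:R)%:P = 'X + c'%:P + 1 :> {poly R} by rewrite [in RHS]polyCB; ring.
ring.
Qed.

Lemma rho_moments : hahn_moments alpha c N rho
  (fun i => rising c' k.+1 * rising (alpha + c') k.+1 * v (k.+1 + i)%N).
Proof.
by have := hahn_moments_shift k.+1 hphi; rewrite (_ : c' + k.+1%:R = c) // -nat1r; ring.
Qed.

(** A zero factor would mean that c or alpha + c is one of 2, ..., k + 1. *)
Lemma link_const_neq0 : rising (2 - c) k * rising (2 - alpha - c) k != 0.
Proof.
have nz (x : R) : ~ nonpos_integer (x - k%:R - 1) -> rising (2 - x) k != 0.
  move=> hx; apply/prodf_neq0 => i _; apply/eqP => e0; apply: hx.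
  exists (k - i.+1)%N; have ik := ltn_ord i.
  have -> : x = 2 + i%:R by apply/eqP; rewrite -subr_eq0 -oppr_eq0 -e0; apply/eqP; ring.
  by rewrite natrB // -nat1r; ring.
by rewrite mulf_neq0 ?nz // -addrA -opprD nz // !addrA.
Qed.

(** By the link, the value at q_n is a multiple of the value of the Hahn
    functional of parameter c - 1 at the contiguous combination, which is the
    Hahn polynomial of that parameter. *)
Lemma mu_q_const m : mu (q k alpha c N m.+1) = 0.
Proof.
apply: (mulfI link_const_neq0); rewrite mulr0.
have kp : ~ nonpos_integer (alpha + (c - 1) - N + 1) by exact: a_nonpole.
have h0 : hahn_moments alpha (c - 1) N (mul_functional (e k) phi)
    (fun i => rising c' k * rising (alpha + c') k * v (k + i)%N).
  by have := hahn_moments_shift k hphi; rewrite (_ : c' + k%:R = c - 1) //; ring.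
have := @hahn_orthogonal _ _ _ _ kp _ _ m.+1 1 h0.
rewrite size_poly1 => /(_ isT); rewrite mulr1 /= /mul_functional -hahn_contiguous //.
have phiZ x p : phi (x *: p) = x * phi p by rewrite linearZ.
rewrite mulrC mulrDl linearD -(@scalerAl _ {poly R}) phiZ => h.
rewrite /q /mu /= /mul_functional (mulrC (rising ('X + _) k)) mulrDl linearD -(@scalerAl _ {poly R}) phiZ.
rewrite mulrDr mulrCA -!dual_hahn_link.
have -> : beta k alpha c N m.+1 = contiguity_coef alpha c N m.+1 * (gamma m.+2 / gamma m.+1) by [].
set e1 := contiguity_coef _ _ _ _ in h *.
transitivity (gamma m.+2 * (phi (hahn m.+1 * e k) + e1 * phi (hahn m * e k))).
  by have g := gamma_neq0 m.+1; field.
by rewrite h mulr0.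
Qed.

Lemma size_q n : size (q k alpha c N n) = n.+1.
Proof.
case: n => [|m]; first by rewrite /= size_poly1.
rewrite /= size_polyDl size_hahn //.
by apply: leq_ltn_trans (size_scale_leq _ _) _; rewrite size_hahn.
Qed.

(** Beyond degree 0, testing the perturbed functional against this basis is
    testing the Hahn functional of parameter c against powers. *)
Definition christoffel_basis j : {poly R} :=
  if j is i.+1 then ('X + c'%:P) * 'X^i else 1.

Lemma christoffel_basis_monic j : christoffel_basis j \is monic.
Proof. by case: j => [|j] /=; rewrite ?monic1 // monicMr ?monicXn // monicXaddC. Qed.

Lemma size_christoffel_basis j : size (christoffel_basis j) = j.+1.
Proof.
case: j => [|j] /=; first by rewrite size_poly1.
by rewrite size_Mmonic ?monicXn ?monic_neq0 ?monicXaddC // size_XaddC size_polyXn.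
Qed.

(** Orthogonality of q_n to all but constants is thus that of two consecutive
    Hahn polynomials; the constant is the one condition that fixes beta_n. *)
Lemma mu_q_basis m j : mu (q k alpha c N m.+1 * christoffel_basis j.+1) =
   rho (hahn m.+1 * 'X^j) + beta k alpha c N m.+1 * rho (hahn m * 'X^j).
Proof.
rewrite /= mulrCA mu_mulXc /q mulrDl linearD -scalerAl [X in _ + X]linearZ //.
Qed.

Lemma mu_q_orthogonal n j : (j < n)%N ->
  mu (q k alpha c N n * christoffel_basis j) = 0.
Proof.
case: n => // m; case: j => [|j] jm; first by rewrite mulr1 mu_q_const.
rewrite mu_q_basis !(hahn_orthogonal a1_nonpole rho_moments) ?size_polyXn //; last by rewrite ltnW.
by rewrite mulr0 addr0.
Qed.

(** For n = 0 the link at degree 0 gives the value as a multiple of gamma_1;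
    for larger n the value is beta_n times a norm of the Hahn polynomials. *)
Lemma mu_q_norm n : rising (1 - N) n != 0 ->
  mu (q k alpha c N n * christoffel_basis n) != 0.
Proof.
have v_neq0 : rising c' k.+1 * rising (alpha + c') k.+1 * v (k.+1 + 0)%N != 0.
  by rewrite addn0 !mulf_neq0 // rising_neq0 //; exact: ac'_nonpole.
case: n => [_|m hN].
  rewrite mulr1 /q; apply/negP => /eqP e0.
  have := dual_hahn_link 0; rewrite -/(mu _) hahn0 !mul1r.
  move: e0; rewrite /mu /= /mul_functional mulr1 => ->; rewrite mulr0 => /eqP.
  rewrite mulf_eq0 (negPf (gamma_neq0 1)) /=.
  have := hahn_moments_plus 0 k hphi; rewrite rising0 mul1r => -> /eqP.
  rewrite rising0 mul1r add0n; apply/eqP.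
  rewrite (proj1 hphi k) (_ : alpha + c' - N + 1 + k%:R = a); last by ring.
  by rewrite !mulf_neq0 ?rising_neq0 //; exact: ac'_nonpole.
move: hN; rewrite risingSr mulf_eq0 negb_or => /andP[hN hm].
rewrite mu_q_basis (hahn_orthogonal a1_nonpole rho_moments) ?size_polyXn // add0r mulf_neq0 //; last first.
  exact: (hahn_norm_neq0 a1_nonpole rho_moments v_neq0 aN_nonpole acc_nonpole c_nonpole hN).
rewrite /beta !mulf_neq0 ?invr_eq0 ?mulf_neq0 ?contiguity_denom1 ?contiguity_denom2 ?pnatr_eq0 //.
  by rewrite -oppr_eq0 (_ : - (N - m.+1%:R) = 1 - N + m%:R) // -nat1r; ring.
by rewrite (_ : m.+1%:R + alpha - N = alpha - N + 1 + m%:R) ?addn_neq0 // -nat1r; ring.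
Qed.

Theorem krall_orthogonal n m : (m < n)%N -> mu (q k alpha c N n * 'X^m) = 0.
Proof.
move=> mn; apply: (graded_functional_eq0 size_christoffel_basis
  (psi := mul_functional (q k alpha c N n) mu) (n := n)); last by rewrite size_polyXn.
by move=> j jn; exact: mu_q_orthogonal.
Qed.

Theorem krall_norm n : rising (1 - N) n != 0 -> mu (q k alpha c N n * 'X^n) != 0.
Proof.
move=> hN.
have psi0 j : (j < n)%N -> mul_functional (q k alpha c N n) mu (christoffel_basis j) = 0.
  by move=> jn; exact: mu_q_orthogonal.
have := graded_functionalE size_christoffel_basis psi0 (p := 'X^n).
rewrite size_polyXn => /(_ (leqnn _)); rewrite /= /mul_functional => ->.
by rewrite coefXn eqxx (monicP (christoffel_basis_monic n)) divr1 mul1r mu_q_norm.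
Qed.

End KrallOrthogonality.

(** * Moments of the two kinds of Hahn functional *)

Section DiscreteMoments.
Variable R : realType.
Local Notation b := (rising (- 'X : {poly R})).

Lemma horner_rising (p : {poly R}) n x : (rising p n).[x] = rising p.[x] n.
Proof.
rewrite /rising horner_prod; apply: eq_bigr => i _.
by rewrite hornerD -polyC_natr hornerC.
Qed.

(** Falling factorials t^_i are absorbed by the binomial coefficient, which
    leaves a Chu-Vandermonde sum of length n - i. *)
Lemma Vandermonde_falling n i (x y : R) :
  \sum_(t < n.+1) 'C(n, t)%:R * (rising x (n - t) * rising y t) * (t ^_ i)%:R =
  (n ^_ i)%:R * rising y i * rising (x + y + i%:R) (n - i).
Proof.
elim: i n y => [|i IH] n y.
  rewrite ffactn0 rising0 !mul1r addr0 subn0 -Vandermonde_rising.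
  by apply: eq_bigr => t _; rewrite ffactn0 mulr1.
case: n => [|n]; first by rewrite big_ord1 ffact0n mulr0 !mul0r.
rewrite big_ord_recl ffact0n mulr0 add0r subSS ffactSS natrM risingSl.
have -> : x + y + i.+1%:R = x + (y + 1) + i%:R by rewrite -nat1r; ring.
transitivity (n.+1%:R * y * \sum_(t < n.+1) 'C(n, t)%:R * (rising x (n - t) * rising (y + 1) t) * (t ^_ i)%:R).
  rewrite mulr_sumr; apply: eq_bigr => t _; rewrite lift0 subSS ffactSS natrM risingSl.
  have := mul_bin_diag n.+1 t => /(congr1 (fun j => j%:R : R)); rewrite /= !natrM => h.
  transitivity (t.+1%:R * 'C(n.+1, t.+1)%:R * (rising x (n - t) * (y * rising (y + 1) t) * (t ^_ i)%:R)).
    by ring.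
  by rewrite -h; ring.
by rewrite IH; ring.
Qed.

Section Weight.
Variables (alpha c : R) (n : nat).
Local Notation N := (n.+1%:R : R).
Hypothesis aN_nonpole : ~ nonpos_integer (alpha - N + 1).
Hypothesis c_nonpole : ~ nonpos_integer c.
Hypothesis ac_nonpole : ~ nonpos_integer (alpha + c).

Let K := Gamma (alpha - n%:R) * Gamma c.

Lemma alphan_nonpole : ~ nonpos_integer (alpha - n%:R).
Proof. by rewrite (_ : alpha - n%:R = alpha - N + 1) // -nat1r; ring. Qed.

(** With the Gamma factors referred to their values at x = n and x = 0, the
    weight becomes a Chu-Vandermonde summand. *)
Lemma hahn_weightE x : (x <= n)%N -> hahn_weight alpha c N x =
  K * ('C(n, x)%:R * (rising (alpha - n%:R) (n - x) * rising c x)).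
Proof.
move=> xn; rewrite /hahn_weight.
have -> : alpha - x%:R = alpha - n%:R + (n - x)%:R by rewrite natrB //; ring.
rewrite (Gamma_rising _ alphan_nonpole) (addrC x%:R) (Gamma_rising _ c_nonpole).
have Nx : ~ nonpos_integer ((n - x).+1%:R : R).
  move=> [m e]; have : (0 : R) < (n - x).+1%:R by rewrite ltr0n.
  by rewrite e oppr_gt0 ltrn0.
have -> : N - x%:R = (n - x).+1%:R by rewrite -subSn // natrB // ltnW.
have GN : Gamma N = (n ^_ x)%:R * Gamma ((n - x).+1%:R : R).
  have {1}-> : N = (n - x).+1%:R + x%:R by rewrite -natrD addSn subnK.
  rewrite (Gamma_rising _ Nx); congr (_ * _).
  rewrite rising_reflect (_ : 1 - (n - x).+1%:R - x%:R = - n%:R); last first.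
    by rewrite -nat1r natrB //; ring.
  by rewrite rising_opp_nat mulrA -exprMn mulrNN mulr1 expr1n mul1r.
have G0 := Gamma_neq0 Nx; have f0 := fact_neq0 R x.
rewrite GN -bin_ffact natrM /K.
by field; rewrite G0 f0.
Qed.

(** A finite product up to index n, continued beyond it by the recurrence. The
    continuation divides by factors alpha + c + i only, which is why it exists
    even when the finite products vanish. *)
Definition discrete_seq s : R :=
  if (s <= n)%N then K * rising (alpha - n%:R + c + s%:R) (n - s)
  else K / rising (alpha + c) (s - n).

Lemma discrete_moments :
  hahn_moments alpha c N (discrete_functional n.+1 (hahn_weight alpha c N)) discrete_seq.
Proof.
split=> [s|i].
  have -> : alpha + c - N + 1 + s%:R = alpha - n%:R + c + s%:R by rewrite -nat1r; ring.
  rewrite /discrete_seq; case: (ltngtP s n) => [sn|ns|->].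
  - rewrite -(subnSK sn) risingSl -nat1r.
    rewrite (_ : alpha - n%:R + c + (1 + s%:R) = alpha - n%:R + c + s%:R + 1); ring.
  - rewrite subSn ?(ltnW ns) // risingSr natrB ?(ltnW ns) //.
    have h1 := rising_neq0 (s - n) ac_nonpole.
    have := addn_neq0 (s - n) ac_nonpole; rewrite natrB ?(ltnW ns) // => h2.
    have h3 : alpha - n%:R + c + s%:R != 0 by apply: contra h2 => /eqP <-; apply/eqP; ring.
    by field; rewrite h1 h2.
  - rewrite subnn subSnn rising0 rising1.
    have h2 := addn_neq0 0 ac_nonpole; rewrite addr0 in h2.
    by field.
rewrite /= /discrete_functional.
transitivity (K * (-1) ^+ i * \sum_(t < n.+1) 'C(n, t)%:R * (rising (alpha - n%:R) (n - t) * rising c t) * (t ^_ i)%:R).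
  rewrite mulr_sumr; apply: eq_bigr => t _.
  rewrite hahn_weightE -1?ltnS // horner_rising hornerN hornerX rising_opp_nat; ring.
rewrite Vandermonde_falling (_ : 1 - N = - n%:R); last by rewrite -nat1r; ring.
rewrite rising_opp_nat /discrete_seq; case: leqP => ni; first by ring.
by rewrite ffact_small // mul0r !(mulr0, mul0r).
Qed.

Lemma discrete_seq_neq0 s : ~ nonpos_integer (alpha + c - N + 1 + s%:R) -> discrete_seq s != 0.
Proof.
have K0 : K != 0 by rewrite mulf_neq0 // Gamma_neq0 //; exact: alphan_nonpole.
rewrite (_ : alpha + c - N + 1 + s%:R = alpha - n%:R + c + s%:R); last by rewrite -nat1r; ring.
move=> hs; rewrite /discrete_seq; case: ifP => _; rewrite mulf_neq0 ?invr_eq0 ?rising_neq0 //.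
Qed.

End Weight.
End DiscreteMoments.

Section OrthogonalMoments.
Variable R : realType.
Variables alpha c N : R.
Local Notation a := (alpha + c - N).
Local Notation b := (rising (- 'X : {poly R})).
Hypothesis a1_nonpole : ~ nonpos_integer (a + 1).

(** Orthogonality of the polynomial of degree i to constants determines the
    i-th moment from the previous ones; the Gauss sum shows that the closed
    form satisfies the same relations. *)
Lemma moments_of_orthogonal rho : orthogonal_on xpredT rho (hahn alpha c N) ->
  hahn_moments alpha c N rho (fun s => rho 1 / rising (a + 1) s).
Proof.
move=> orth; split=> [s|i].
  rewrite risingSr; have h1 := rising_neq0 s a1_nonpole; have h2 := addn_neq0 s a1_nonpole.
  by field; rewrite h1 h2.
have [n] := ubnP i; elim: n i => // n IH [|i] ni.
  by rewrite !rising0 divr1 !mul1r.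
have [_ /(_ 0%N isT) + _] := orth i.+1 isT.
rewrite expr0 mulr1 (hahnE alpha c N (ltnSn i.+1)) linear_sum big_ord_recr /= linearZ /=.
have /(congr1 (fun x => x * rho 1)) := hahn_coef_sum a1_nonpole i.+1 0.
rewrite (_ : 1 + 0%:R - i.+1%:R = - i%:R); last by rewrite -nat1r; ring.
rewrite rising_opp_nat ffact_small // !mulr0 !mul0r big_ord_recr /= mulrDl mulr_suml addn0 => S0 S1.
move: (etrans S1 (esym S0)) => {S0 S1}.
have -> : \sum_(j < i.+1) rho (hahn_coef alpha c N i.+1 j *: b j) =
   \sum_(j < i.+1) hahn_coef alpha c N i.+1 j * (rising (1 - N) j * rising c j / rising (a + 1) (j + 0)) * rho 1.
  apply: eq_bigr => j _; rewrite linearZ /= IH; last by apply: leq_trans (ltn_ord j) _.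
  by rewrite addn0; ring.
have s0 : (-1) ^+ i.+1 != 0 :> R by rewrite signr_eq0.
move=> /addrI; rewrite hahn_coefnn -(mulrA ((-1) ^+ _)) => /(mulfI s0) ->.
ring.
Qed.

End OrthogonalMoments.

Section Transform.
Variable R : realType.
Variables (k : nat) (alpha c N : R).

Lemma transform_factor (x : R) :
  \prod_(1 <= i < k.+1) ('X + (x - i%:R)%:P) = rising ('X + (x - k%:R)%:P) k.
Proof.
elim: k => [|n IH]; first by rewrite big_nil rising0.
rewrite big_nat_recr //= IH risingSl mulrC; congr (_ * rising _ _).
by rewrite -nat1r opprD !addrA !polyCB; ring.
Qed.

Lemma rho_tildeE rho p : rho_tilde k c rho p =
  mul_functional (rising ('X + (c - k%:R)%:P) k) rho p.
Proof. by rewrite /rho_tilde /= /mul_functional transform_factor. Qed.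

Lemma rho_tilde_discrete M p : ~ nonpos_integer (c - k%:R - 1) ->
  rho_tilde k c (discrete_functional M (hahn_weight alpha (c - k%:R - 1) N)) p =
  discrete_functional M (rho_tilde_weight k alpha c N) p.
Proof.
move=> c'_nonpole; rewrite rho_tildeE /= /mul_functional /discrete_functional.
apply: eq_bigr => x _; rewrite hornerM horner_rising hornerD hornerX hornerC mulrA; congr (_ * _).
rewrite /hahn_weight /rho_tilde_weight.
set y := x%:R + (c - k%:R - 1).
have y_nonpole : ~ nonpos_integer y by rewrite /y addrC => /nonpos_integerD.
have -> : x%:R + c - k%:R - 1 = y by rewrite /y; ring.
have -> : x%:R + c = y + k.+1%:R by rewrite /y -nat1r; ring.
have -> : x%:R + (c - k%:R) = y + 1 by rewrite /y; ring.
have y0 := addn_neq0 0 y_nonpole; rewrite addr0 in y0.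
rewrite (Gamma_rising _ y_nonpole) risingSl.
move: (Gamma (N - _)) (Gamma y) (Gamma N) => G Gy GN.
rewrite !invfM; move: (G^-1) => u.
by have x0 := fact_neq0 R x; field; rewrite x0 y0.
Qed.

End Transform.

(** * Krall-Hahn polynomials *)

Theorem theorem7p5 (R : realType) (k : nat) (alpha c N : R)
  (hk : (1 <= k)%N)
  (h1 : ~ nonpos_integer (alpha + c - N + 1))
  (h2 : ~ nonpos_integer (alpha - N + 1))
  (h3 : ~ nonpos_integer (alpha + c - k%:R - 1))
  (h4 : ~ nonpos_integer (c - k%:R - 1))
  (* the denominator of beta_1 does not vanish *)
  (h5 : alpha + c - N != 0)
  (hgamma : forall n : nat,
     (dual_hahn k alpha c N).[n%:R * (n%:R - 2 - N + alpha + c)] != 0) :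
  [/\ size (P2 k alpha c N) = k.+1 /\ size (P1 k alpha c N) = k.+2,
      ~ pos_integer N ->
        forall rho : {scalar {poly R}},
          hahn_functional alpha (c - k%:R - 1) N rho ->
          orthogonal_on xpredT (rho_tilde k c rho) (q k alpha c N),
      forall M : nat, (0 < M)%N -> N = M%:R ->
        let mu : {scalar {poly R}} :=
          discrete_functional M (rho_tilde_weight k alpha c N) in
        [/\ forall rho : {scalar {poly R}},
              hahn_functional alpha (c - k%:R - 1) N rho ->
              forall p, rho_tilde k c rho p = mu p,
            orthogonal_on (fun n => (n < M)%N) mu (q k alpha c N),
            size (q k alpha c N M) = M.+1
          & forall m : nat, (m < M)%N -> mu (q k alpha c N M * 'X^m) = 0],
      has_genre (D_op k alpha c N) (- k.+1%:Z) k.+1%:Z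
        /\ has_order (D_op k alpha c N) (2 * k + 2)
    & forall n : nat,
        D_op k alpha c N (q k alpha c N n)
        = lambda k alpha c N n *: q k alpha c N n].
Proof.
have c1 := c1_nonpole h4.
split.
- by split; [exact: size_P2|exact: size_P1].
- move=> Npos rho [[_ [[a'1 _ _ _] [orth _]]]|[M [M0 NM _]]]; last by case: Npos; exists M.
  have mom := moments_of_orthogonal a'1 orth.
  have rho1 : rho 1 != 0.
    by have [_ _] := orth 0%N isT; rewrite hahn0 mul1r expr0.
  have vk : rho 1 / rising (alpha + (c - k%:R - 1) - N + 1) k.+1 != 0.
    by rewrite mulf_neq0 // invr_eq0 rising_neq0.
  move=> n _; split; first exact: size_q.
  + by move=> m mn; rewrite rho_tildeE; exact: (krall_orthogonal h1 h3 h4 h5 hgamma mom mn).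
  rewrite rho_tildeE; apply: (krall_norm h1 h2 h3 h4 h5 hgamma mom vk).
  apply/prodf_neq0 => i _; apply/negP => /eqP e; apply: Npos; exists i.+1; split=> //.
  by apply/eqP; rewrite -subr_eq0 -oppr_eq0 -e -nat1r; apply/eqP; ring.
- move=> M M0 NM mu.
  have muE : forall p, mu p = mul_functional (rising ('X + (c - k%:R)%:P) k)
      (discrete_functional M (hahn_weight alpha (c - k%:R - 1) N)) p.
    by move=> p; rewrite -rho_tildeE rho_tilde_discrete.
  have [n Mn] : exists n, M = n.+1 by case: (M) M0 => // n _; exists n.
  move: muE; rewrite {}/mu; subst M N => muE.
  have ac' : ~ nonpos_integer (alpha + (c - k%:R - 1)) by rewrite !addrA.
  have mom := discrete_moments h2 h4 ac'.
  have vk : discrete_seq alpha (c - k%:R - 1) n k.+1 != 0.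
    apply: discrete_seq_neq0 => //.
    by rewrite (_ : _ + k.+1%:R = alpha + c - n.+1%:R + 1) // -[k.+1%:R]nat1r; ring.
  split.
  + move=> rho [[nN _]|[M' [_ /eqP + rhoE]]] p; first by case: nN; exists n.+1.
    rewrite eqr_nat => /eqP MM'; subst M'.
    rewrite [RHS]/= -rho_tilde_discrete // !rho_tildeE /= /mul_functional; exact: rhoE.
  + move=> m mn; split; first exact: size_q.
    * by move=> j jm; rewrite muE; exact: (krall_orthogonal h1 h3 h4 h5 hgamma mom jm).
    rewrite muE; apply: (krall_norm h1 h2 h3 h4 h5 hgamma mom vk).
    rewrite (_ : 1 - n.+1%:R = - n%:R); last by rewrite -nat1r; ring.
    by rewrite rising_opp_nat mulf_neq0 ?signr_eq0 // pnatr_eq0 -lt0n ffact_gt0.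
  + exact: size_q.
  + by move=> j jm; rewrite muE; exact: (krall_orthogonal h1 h3 h4 h5 hgamma mom jm).
- by split; [exact: D_op_genre|exact: D_op_order].
- by move=> n; apply: D_op_eigen.
Qed.
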